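(* Let $\xi \sim N(0,1)$ and suppose that (1) the sequence $\left(\frac{1}{n} \sum_{k=1}^n p_k \sigma_k^2\right)_n$ converges to some $L \in [0,\infty)$, (2) the sequence $\left(\frac{1}{n} \sum_{k=1}^n p_k\right)_n$ converges to $0$, (3) the sequence $\left(\frac{1}{s_n^2} \max_{1 \leq k \leq n} p_k \sigma_k^2\right)_n$ converges to $0$. Then $$\limsup_{n \rightarrow \infty} K\left(\xi, \frac{n}{s_n}\left(\overline{X}_n - \mu\right)\right) \leq \frac{L}{1+L}.$$
   Context: Let $F$ be a cumulative distribution function on $\mathbb{R}$ with $\int_{-\infty}^\infty x\, dF(x) = 0$ and $\int_{-\infty}^\infty x^2\, dF(x) = 1$. Fix $\mu \in \mathbb{R}$, and for each integer $k \geq 1$ let $p_k \in [0,1]$ and $\sigma_k \in [1,\infty)$. Let $X_1, X_2, \ldots$ be independent random variables such that, for each $k$, $X_k$ has cumulative distribution function $x \mapsto (1-p_k) F(x-\mu) + p_k F\left(\frac{x-\mu}{\sigma_k}\right)$. Put $\overline{X}_n = \frac{1}{n} \sum_{k=1}^n X_k$ and $s_n^2 = \sum_{k=1}^n [(1-p_k) + p_k \sigma_k^2]$, with $s_n > 0$. The Kolmogorov distance between real random variables $\eta$ and $\eta'$ is $K(\eta,\eta') = \sup_{x \in \mathbb{R}} \left|\mathbb{P}[\eta \leq x] - \mathbb{P}[\eta' \leq x]\right|$. *)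

(* Defs.v *)
(* The families (X_k), (p_k), (sigma_k), k >= 1, are indexed
   from 0 here: [X k] stands for X_(k+1), so that a sum over k = 1, ..., n is a
   sum over [k < n]. *)
From HB Require Import structures.
From mathcomp Require Export all_boot all_order all_algebra finmap.
From mathcomp Require Export all_classical all_reals all_analysis measurable_realfun.

Set Implicit Arguments.
Unset Strict Implicit.
Unset Printing Implicit Defensive.
Import Order.TTheory GRing.Theory Num.Theory.
Import numFieldNormedType.Exports.
Local Open Scope classical_set_scope.
Local Open Scope ring_scope.

Definition mutually_independent d (T : measurableType d) (R : realType)
    (P : probability T R) (I : choiceType) (X : I -> {RV P >-> R}) : Prop :=
  forall (J : {fset I}) (B : I -> set R),
    (forall i, measurable (B i)) ->
    P (\bigcap_(i in [set` J]) (X i @^-1` B i)) =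
      (\prod_(i <- J) P (X i @^-1` B i))%E.

(* The two random variables may live on different probability spaces. *)
Definition kolmogorov_distance d (T : measurableType d) d'
    (T' : measurableType d') (R : realType) (P : probability T R)
    (P' : probability T' R) (eta : {RV P >-> R}) (eta' : {RV P' >-> R}) :
    \bar R :=
  ereal_sup [set `|cdf eta x - cdf eta' x|%E | x in [set: R]].

Definition has_standard_normal_law d (T : measurableType d) (R : realType)
    (P : probability T R) (xi : {RV P >-> R}) : Prop :=
  forall A : set R, measurable A -> distribution P xi A = normal_prob 0 1 A.

Section contaminated_sample.
Context d (T : measurableType d) (R : realType) (P : probability T R).
Implicit Types (p sigma : nat -> R) (X : nat -> {RV P >-> R}) (mu : R).

Definition var_sum p sigma (n : nat) : R :=
  \sum_(k < n) ((1 - p k) + p k * sigma k ^+ 2).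

Definition std_sum p sigma (n : nat) : R := Num.sqrt (var_sum p sigma n).

Definition sample_mean X (n : nat) (w : T) : R :=
  n%:R^-1 * \sum_(k < n) X k w.

Definition std_sample_mean p sigma X mu (n : nat) (w : T) : R :=
  n%:R / std_sum p sigma n * (sample_mean X n w - mu).

Lemma measurable_std_sample_mean p sigma X mu n :
  measurable_fun [set: T] (std_sample_mean p sigma X mu n).
Proof.
apply: measurable_funM => //; apply: measurable_funB => //.
apply: measurable_funM => //.
elim: n => [|n IHn].
  by under eq_fun do rewrite big_ord0; exact: measurable_cst.
under eq_fun do rewrite big_ord_recr /=.
by apply: measurable_funD.
Qed.

HB.instance Definition _ p sigma X mu n :=
  isMeasurableFun.Build _ _ _ _ (std_sample_mean p sigma X mu n)
    (measurable_std_sample_mean p sigma X mu n).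

End contaminated_sample.

(* Main.v *)
Require Import Defs.
From HB Require Import structures.
From mathcomp Require Import ring lra.

Set Implicit Arguments.
Unset Strict Implicit.
Unset Printing Implicit Defensive.
Import Order.TTheory GRing.Theory Num.Theory.
Import numFieldNormedType.Exports.
Local Open Scope classical_set_scope.
Local Open Scope ring_scope.

(** Stein's method with its sharp constant.

    For real z, the function f = stein z satisfies
      f'(w) - w f(w) = 1[w <= z] - Phi z   for w != z,
    so that P[W <= z] - Phi z is the expectation of f'(W) - W f(W). The values
    of f' lie in an interval [m, M] of length exactly 1 ([stein_slopes],
    [stein_jump]): f' increases on both sides of z and drops by 1 at z.

    Let W be the standardized mean, that is, the sum of the variables
    xi_k = (X_k - mu) / s_n, and let W_k = W - xi_k, which is independent of
    xi_k ([sum_over_indep]). Because xi_k is centred and the variances of the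
    xi_k add up to 1, the expectation of f'(W) - W f(W) is the sum over k of
      Var(xi_k) E f'(W) - E[xi_k (f(W_k + xi_k) - f(W_k))].
    The law of X_k is a mixture of two scalings of F, and each term splits
    accordingly ([summand_error]).
    - With weight 1 - p_k the scale is 1 / s_n, and b (f(W_k + b) - f(W_k)) is
      b^2 f'(W_k) up to a Taylor remainder of smaller order. Integrated
      against F this remainder is negligible by dominated convergence
      ([lindeberg_tail_cvg0]), and replacing W_k by W in f' costs
      O(1 / s_n) + p_k.
    - With weight p_k the scale sigma_k / s_n need not be small, and no Taylor
      expansion is possible. But both quantities to be compared lie between m
      and M times sigma_k^2 / s_n^2, so they differ by at most
      sigma_k^2 / s_n^2.
    Summing over k ([stein_equation_bound]), all that survives is the
    contaminated share of the variance, the sum of the p_k sigma_k^2 divided by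
    s_n^2. It tends to L / (1 + L) because s_n^2 / n tends to 1 + L
    ([stein_error_cvg]).

    The Taylor expansion requires f' to be continuous, so f is first averaged
    over a window of length delta ([smooth_stein]). This keeps the slopes
    within [m, M], makes the derivative (2 / delta)-Lipschitz, and perturbs
    Stein's equation by at most 3 delta, uniformly in z. The error bound is
    thus uniform in z and controls the Kolmogorov distance
    ([kolmogorov_distance_bound]); delta is sent to 0 after n to infinity. *)

(** * Primitives and mean value inequalities *)

Section primitive.
Context {R : realType}.
Implicit Types f : R -> R.
Local Notation leb := (@lebesgue_measure R).

Lemma continuous_integrable_segment f (a b : R) : continuous f ->
  leb.-integrable `[a, b] (EFin \o f).
Proof.
move=> cf; apply: continuous_compact_integrable; first exact: segment_compact.
exact: continuous_subspaceT.
Qed.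

(** Near a point x, the signed integral from 0 differs by a constant from the
    integral from a, for any a to the left of 0 and x, and the fundamental
    theorem of calculus applies to the latter. *)
Lemma continuous_has_primitive f : continuous f ->
  exists F : R -> R, forall x : R, is_derive x 1 F (f x).
Proof.
move=> cf.
pose F x : R := (\int[leb]_(t in `[0, x]) f t - \int[leb]_(t in `[x, 0]) f t)%R.
have FE (a x : R) : a <= 0 -> a <= x ->
    F x = (\int[leb]_(t in `[a, x]) f t - \int[leb]_(t in `[a, 0]) f t)%R.
  move=> a0 ax; rewrite /F.
  have [x0|/ltW x0] := leP 0 x.
  - rewrite (@Rintegral_itvB _ f (BLeft a) (BRight x) 0)//; last first.
      exact: continuous_integrable_segment.
    rewrite Rintegral_itv_obnd_cbnd; last first.
      by apply: integrableS (continuous_integrable_segment a x cf) => //;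
        apply: subset_itvr; rewrite bnd_simp.
    move: x0; rewrite le_eqVlt => /predU1P[<-|x0].
      by rewrite set_itv1 Rintegral_set1 subr0.
    by rewrite (@set_itv_ge _ _ (BLeft x))// ?Rintegral_set0 ?subr0// bnd_simp -ltNge.
  - rewrite -[RHS]opprB (@Rintegral_itvB _ f (BLeft a) (BRight 0) x)//; last first.
      exact: continuous_integrable_segment.
    rewrite Rintegral_itv_obnd_cbnd; last first.
      by apply: integrableS (continuous_integrable_segment a 0 cf) => //;
        apply: subset_itvr; rewrite bnd_simp.
    move: x0; rewrite le_eqVlt => /predU1P[->|x0].
      by rewrite set_itv1 Rintegral_set1 subr0 oppr0.
    by rewrite (@set_itv_ge _ _ (BLeft 0))// ?Rintegral_set0 ?sub0r// bnd_simp -ltNge.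
exists F => x.
pose a := - `|x| - 1.
have a0 : a < 0 by rewrite /a; have := normr_ge0 x; lra.
have ax : a < x by rewrite /a; have := ler_norm (- x); rewrite normrN; lra.
pose I y := (\int[leb]_(t in `[a, y]) f t)%R.
pose G y := I y - I 0.
have [dI I'] := @continuous_FTC1_closed _ f a x (x + 1) (ltac:(lra))
  (continuous_integrable_segment a (x + 1) cf) ax (cf x).
have iI : is_derive x 1 I (f x).
  by apply: DeriveDef; [exact: dI|rewrite -derive1E; exact: I'].
have iG : is_derive x 1 G (f x).
  by rewrite -[f x]subr0; exact: (is_deriveB iI (is_derive_cst (I 0) x 1)).
have nFG : \forall y \near x, G y = F y.
  near=> y; apply/esym/FE; first exact: ltW.
  by apply/ltW; near: y; exact: lt_nbhsr.
exact: near_eq_is_derive nFG iG.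
Unshelve. all: by end_near. Qed.
End primitive.

Section mean_value.
Context {R : realType}.
Implicit Types f df : R -> R.

Lemma is_derive_continuous f df :
  (forall x : R, is_derive x 1 f (df x)) -> continuous f.
Proof.
move=> fdf x; apply/differentiable_continuous/derivable1_diffP.
by have [] := fdf x.
Qed.

Lemma mean_value_bounds f df (m M a b : R) : a <= b -> continuous f ->
  (forall x : R, a < x -> x < b -> is_derive x 1 f (df x)) ->
  (forall x : R, a < x -> x < b -> m <= df x <= M) ->
  m * (b - a) <= f b - f a <= M * (b - a).
Proof.
move=> ab cf fdf dfmM.
move: ab; rewrite le_eqVlt => /predU1P[<-|ab]; first by rewrite !subrr !mulr0 lexx.
have [] := @MVT R f df a b ab.
- by move=> x; rewrite in_itv/= => /andP[ax xb]; exact: fdf.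
- exact: continuous_subspaceT.
move=> c; rewrite in_itv/= => /andP[ac cb] ->.
have /andP[? ?] := dfmM _ ac cb.
by rewrite !ler_wpM2r// subr_ge0 ltW.
Qed.

(** Serves to compare Phi with phi through derivatives, without estimating
    integrals. *)
Lemma cvgNy_ge0 f df (b : R) : (forall x : R, is_derive x 1 f (df x)) ->
  (forall x, x <= b -> 0 <= df x) -> f x @[x --> -oo] --> (0 : R) ->
  forall x, x <= b -> 0 <= f x.
Proof.
move=> fdf df0 f0 x xb.
apply: (cvgr_to_le f0); exists x; split; first exact: num_real.
move=> y /ltW yx.
have [] := @MVT_segment R f df y x yx.
- exact/continuous_subspaceT/(is_derive_continuous fdf).
- move=> c; rewrite in_itv/= => /andP[yc cx] fE.
  by rewrite -subr_ge0 fE mulr_ge0 ?subr_ge0// df0// (le_trans cx).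
Qed.
End mean_value.

(** * The standard normal density and distribution function *)

Definition real_id {R : realType} : measurableTypeR R -> R := idfun.

HB.instance Definition _ (R : realType) :=
  @isMeasurableFun.Build _ _ _ _ (@real_id R) (@measurable_id _ _ setT).

Definition phi {R : realType} (x : R) : R := normal_pdf 0 1 x.
Definition Phi {R : realType} (x : R) : R := fine (normal_prob 0 1 `]-oo, x]).

(** The Mills ratio (1 - Phi) / phi, evaluated at - x. *)
Definition mills {R : realType} (x : R) : R := Phi x / phi x.

Section gauss.
Context {R : realType}.
Implicit Types x : R.

Lemma phiE x : phi x = normal_peak 1 * expR (- x ^+ 2 / 2).
Proof. by rewrite /phi normal_pdfE ?oner_neq0// /normal_fun subr0 expr1n. Qed.

Lemma phi_gt0 x : 0 < phi x.
Proof. by rewrite phiE mulr_gt0 ?expR_gt0// normal_peak_gt0// oner_neq0. Qed.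

Lemma phiN x : phi (- x) = phi x.
Proof. by rewrite !phiE sqrrN. Qed.

Lemma is_derive_phi (x : R) : is_derive x 1 phi (- (x * phi x)).
Proof.
have dq : is_derive x 1 (fun y : R => - y ^+ 2 / 2) (- x).
  have -> : (fun y : R => - y ^+ 2 / 2) = (- 2^-1) *: (@id R ^+ 2).
    by apply/funext => y; rewrite mulNr mulrC -mulNr.
  by apply: is_derive_eq; rewrite /GRing.scale/=; lra.
have -> : @phi R = normal_peak 1 *: (expR \o (fun y : R => - y ^+ 2 / 2)).
  by apply/funext => y; exact: phiE.
apply: is_derive_eq.
change (normal_peak 1 * (expR (- x ^+ 2 / 2) * - x) =
  - (x * (normal_peak 1 * expR (- x ^+ 2 / 2)))).
ring.
Qed.

Lemma is_derive_Phi (x : R) : is_derive x 1 Phi (phi x).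
Proof.
have iphi : (@lebesgue_measure R).-integrable `]-oo, x + 1] (EFin \o phi).
  by apply: integrableS (integrable_normal_pdf 0 1).
have [dI I'] := @continuous_FTC1 R phi -oo%O x (x + 1) (ltac:(lra)) iphi
  (ltNyr x) (@continuous_normal_pdf R 0 1 (oner_neq0 R) x).
by apply: DeriveDef; [exact: dI|rewrite -derive1E; exact: I'].
Qed.

Lemma is_derive_mills x : is_derive x 1 mills (1 + x * mills x).
Proof.
have iV := @is_deriveV R phi x _ 1 (lt0r_neq0 (phi_gt0 x)) (is_derive_phi x).
have -> : mills = Phi * (fun y => (phi y)^-1) by [].
have iP := is_derive_Phi x.
apply: is_derive_eq.
change (Phi x * (- (phi x ^+ 2)^-1 * - (x * phi x)) + (phi x)^-1 * phi x =
  1 + x * (Phi x / phi x)).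
by field; exact: lt0r_neq0 (phi_gt0 x).
Qed.

Lemma cvgNy0_of_inv_bound f (c : R) : (forall x, x <= -1 -> `|f x| <= c / - x) ->
  f x @[x --> -oo] --> (0 : R).
Proof.
move=> fc; apply/cvgrPdist_le => e e0.
exists (Num.min (-1) (- (`|c| / e))); split; first exact: num_real.
move=> x; rewrite lt_min sub0r normrN => /andP[/ltW x1 xc].
apply: (le_trans (fc _ x1)); rewrite ler_pdivrMr; last lra.
have : `|c| / e < - x by lra.
by rewrite ltr_pdivrMr// mulrC => /ltW; apply: le_trans; exact: ler_norm.
Qed.

Lemma normal_peak1_le1 : normal_peak 1 <= 1 :> R.
Proof.
rewrite /normal_peak expr1n mul1r invf_le1.
  by rewrite -[leLHS]sqrtr1 ler_wsqrtr// mulr2n; have := @pi_ge2 R; lra.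
by rewrite sqrtr_gt0 mulrn_wgt0// pi_gt0.
Qed.

Lemma phi_le1 x : phi x <= 1.
Proof.
by rewrite (le_trans (normal_pdf_ub _ _ (oner_neq0 R)))// normal_peak1_le1.
Qed.

Lemma phi_tail x : x <= -1 -> phi x <= 16 / x ^+ 4.
Proof.
move=> x1; rewrite phiE mulNr expRN.
have x2 : 0 < x ^+ 2 by rewrite exprn_even_gt0//=; lra.
have e4 : x ^+ 4 / 16 <= expR (x ^+ 2 / 2).
  (* expR (x^2 / 2) is the square of expR (x^2 / 4), which exceeds x^2 / 4 *)
  have -> : x ^+ 2 / 2 = (x ^+ 2 / 4) *+ 2 by rewrite -mulr_natr; lra.
  have -> : x ^+ 4 / 16 = (x ^+ 2 / 4) ^+ 2 by field.
  rewrite mulr2n expRD -expr2 lerXn2r// ?nnegrE ?expR_ge0//; first by lra.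
  by have := expR_ge1Dx (x ^+ 2 / 4); lra.
have pk := normal_peak1_le1.
have x4 : 0 < x ^+ 4 by rewrite exprn_even_gt0//=; lra.
rewrite -[leRHS]mul1r ler_pM ?normal_peak_ge0 ?invr_ge0 ?expR_ge0//.
by rewrite -[leRHS]invrK invf_div lef_pV2// posrE ?expR_gt0// divr_gt0.
Qed.

Lemma sqr_phi_tail x : x <= -1 -> x ^+ 2 * phi x <= 16 / - x.
Proof.
move=> x1; apply: (@le_trans _ _ (16 / x ^+ 2)).
  have -> : 16 / x ^+ 2 = x ^+ 2 * (16 / x ^+ 4) by field; lra.
  by rewrite ler_wpM2l ?sqr_ge0// phi_tail.
rewrite ler_pM2l; last lra.
by rewrite lef_pV2 ?posrE; nra.
Qed.

Lemma cvg_phi : phi x @[x --> -oo] --> (0 : R).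
Proof.
apply: (@cvgNy0_of_inv_bound _ 16) => x x1; rewrite gtr0_norm ?phi_gt0//.
apply: le_trans (sqr_phi_tail x1).
by rewrite ler_peMl ?(ltW (phi_gt0 x))//; nra.
Qed.

Lemma Phi_ge0 x : 0 <= Phi x.
Proof. exact: fine_ge0. Qed.

Lemma Phi_le1 x : Phi x <= 1.
Proof.
rewrite -lee_fin fineK ?probability_le1//.
exact: fin_num_measure.
Qed.

Let cdf_real_id : cdf (real_id : {RV (normal_prob 0 1) >-> R}) = EFin \o Phi.
Proof.
apply/funext => x /=; rewrite /Phi fineK ?fin_num_measure//.
Qed.

Lemma cvg_PhiNy : Phi x @[x --> -oo] --> (0 : R).
Proof.
have := cvg_cdfNy0 (real_id : {RV (normal_prob 0 1) >-> R}).
by rewrite cdf_real_id => /fine_cvg.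
Qed.

Lemma cvg_Phiy : Phi x @[x --> +oo] --> (1 : R).
Proof.
have := cvg_cdfy1 (real_id : {RV (normal_prob 0 1) >-> R}).
by rewrite cdf_real_id => /fine_cvg.
Qed.

Lemma PhiN x : Phi (- x) = 1 - Phi x.
Proof.
pose S := fun y : R => Phi y + Phi (- y).
have dS (y : R) : is_derive y 1 S 0.
  have iP := is_derive_Phi y.
  have iPN := @is_derive1_comp R Phi -%R y _ _ (is_derive_Phi (- y)) (is_deriveNid y 1).
  have -> : S = Phi + (Phi \o -%R) by [].
  by apply: is_derive_eq; rewrite phiN mulrN1 subrr.
have SE y : S y = S x by exact: is_derive_0_is_cst.
have S1 : S y @[y --> +oo] --> (1 : R).
  rewrite -[X in _ --> X]addr0; apply: cvgD; first exact: cvg_Phiy.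
  by have := cvg_PhiNy; rewrite cvgNy_compNP.
have S2 : S y @[y --> +oo] --> S x.
  by rewrite (_ : S = cst (S x)); [exact: cvg_cst|apply/funext].
have : 1 = S x by exact: (cvg_unique (@Rhausdorff R) S1 S2).
by rewrite /S; lra.
Qed.

(** On this half-line phi grows at least as fast as Phi, since its derivative
    there is - x phi x >= phi x. *)
Lemma Phi_le_phi x : x <= -1 -> Phi x <= phi x.
Proof.
move=> x1; rewrite -subr_ge0.
pose D := phi - (Phi : R -> R).
pose dD := fun y : R => - (y * phi y) - phi y.
apply: (@cvgNy_ge0 _ D dD (-1)) => //.
- move=> y; rewrite /D.
  by have := is_derive_phi y; have := is_derive_Phi y => ? ?; exact: is_deriveB.
- move=> y y1; rewrite /dD.
  have -> : - (y * phi y) - phi y = (- y - 1) * phi y by ring.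
  by rewrite mulr_ge0 ?(ltW (phi_gt0 y))//; lra.
- by rewrite -[X in _ --> X]subr0; apply: cvgB; [exact: cvg_phi|exact: cvg_PhiNy].
Qed.

Lemma is_derive_xPhi_phi x :
  is_derive x 1 (fun y : R => y * Phi y + phi y) (Phi x).
Proof.
have -> : (fun y : R => y * Phi y + phi y) = @id R * Phi + phi by [].
have := is_derive_phi x; have := is_derive_Phi x => ? ?.
apply: is_derive_eq.
change (x * phi x + Phi x * 1 + - (x * phi x) = Phi x); ring.
Qed.

(** Up to the factor phi, this is the derivative of [mills]; its own derivative
    is Phi. *)
Lemma xPhi_phi_ge0 x : 0 <= x * Phi x + phi x.
Proof.
apply: (@cvgNy_ge0 _ (fun y => y * Phi y + phi y) Phi x) => //.
- exact: is_derive_xPhi_phi.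
- by move=> ? _; exact: Phi_ge0.
- apply: (@cvgNy0_of_inv_bound _ 32) => y y1.
  have pp := Phi_le_phi y1; have p2 := sqr_phi_tail y1.
  have p0 := phi_gt0 y; have P0 := Phi_ge0 y.
  have a1 : - y * Phi y <= y ^+ 2 * phi y by rewrite ler_pM//; nra.
  have a2 : phi y <= y ^+ 2 * phi y by rewrite ler_peMl; nra.
  have a3 : 0 <= - y * Phi y by rewrite mulr_ge0//; lra.
  by rewrite ler_norml; apply/andP; split; lra.
Qed.

(** Up to the factor phi, this is the second derivative of [mills]; its own
    derivative is twice the quantity of [xPhi_phi_ge0]. *)
Lemma x2Phi_xphi_ge0 x : 0 <= (1 + x ^+ 2) * Phi x + x * phi x.
Proof.
pose Q := fun y : R => y * Phi y + phi y.
pose D := Phi + @id R * Q.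
have DE y : D y = (1 + y ^+ 2) * Phi y + y * phi y.
  change (Phi y + y * (y * Phi y + phi y) = (1 + y ^+ 2) * Phi y + y * phi y); ring.
have dD (y : R) : is_derive y 1 D (2 * Q y).
  have iQ : is_derive y 1 Q (Phi y) := is_derive_xPhi_phi y.
  apply: (is_derive_eq (is_deriveD (is_derive_Phi y)
    (is_deriveM (is_derive_id y 1) iQ))).
  change (phi y + (y * Phi y + Q y * 1) = 2 * Q y); rewrite /Q; ring.
rewrite -DE.
apply: (@cvgNy_ge0 _ D _ x) => //.
  by move=> y _; rewrite mulr_ge0// xPhi_phi_ge0.
apply: (@cvgNy0_of_inv_bound _ 48) => y y1.
rewrite DE.
have pp := Phi_le_phi y1; have p2 := sqr_phi_tail y1.
have p0 := phi_gt0 y; have P0 := Phi_ge0 y.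
have a1 : (1 + y ^+ 2) * Phi y <= 2 * (y ^+ 2 * phi y).
  by rewrite [leRHS]mulrA ler_pM//; nra.
have a2 : - y * phi y <= y ^+ 2 * phi y by rewrite ler_wpM2r//; nra.
have a3 : 0 <= (1 + y ^+ 2) * Phi y by rewrite mulr_ge0//; nra.
have a4 : 0 <= - y * phi y by rewrite mulr_ge0//; lra.
rewrite ler_norml; apply/andP; split; lra.
Qed.

End gauss.

(** * Stein's equation for half-lines *)

Section slopes.
Context {R : realType}.
Implicit Types (f df : R -> R) (m M : R).

Definition slopes_between f m M :=
  forall x y : R, x <= y -> m * (y - x) <= f y - f x <= M * (y - x).

Lemma slopes_between_normr f m M : -1 <= m -> M <= 1 -> slopes_between f m M ->
  forall x y : R, `|f y - f x| <= `|y - x|.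
Proof.
move=> m1 M1 fmM x y.
wlog xy : x y / x <= y.
  by move=> h; have [/h //|/ltW/h] := leP x y; rewrite distrC (distrC x).
have /andP[h1 h2] := fmM _ _ xy.
by rewrite (ger0_norm (_ : 0 <= y - x)) ?subr_ge0// ler_norml; apply/andP; split; nra.
Qed.

Lemma lipschitz_continuous f (K : R) :
  (forall x y : R, `|f y - f x| <= K * `|y - x|) -> continuous f.
Proof.
move=> fL x; apply/cvgrPdist_le => e e0.
have K1 : 0 < `|K| + 1 by rewrite ltr_wpDl.
exists (e / (`|K| + 1)) => /=; first by rewrite divr_gt0.
move=> y /ltW; rewrite ler_pdivlMr// => xy.
rewrite (le_trans (fL _ _))// (le_trans _ xy)// mulrC ler_wpM2l//.
by rewrite (le_trans (ler_norm K))// lerDl.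
Qed.
End slopes.

Section stein_solution.
Context {R : realType}.
Implicit Types w x y z : R.

Definition dmills w : R := 1 + w * mills w.

Lemma dmillsE w : dmills w = (w * Phi w + phi w) / phi w.
Proof. by rewrite /dmills /mills; field; exact: lt0r_neq0 (phi_gt0 w). Qed.

Lemma dmills_ge0 w : 0 <= dmills w.
Proof. by rewrite dmillsE divr_ge0 ?xPhi_phi_ge0// ltW// phi_gt0. Qed.

Lemma is_derive_dmills w : is_derive w 1 dmills (w * dmills w + mills w).
Proof.
have -> : dmills = cst 1 + @id R * mills by [].
have idM : is_derive w 1 (@id R * mills) (w * dmills w + mills w * 1).
  exact: is_deriveM (is_derive_id w 1) (is_derive_mills w).
have idD := is_deriveD (is_derive_cst (1 : R) (w : R) (1 : R)) idM.
apply: (is_derive_eq idD).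
change (0 + (w * dmills w + mills w * 1) = w * dmills w + mills w); ring.
Qed.

Lemma dmills_nondecreasing x y : x <= y -> dmills x <= dmills y.
Proof.
move=> xy; rewrite -subr_ge0 -(mul0r (y - x)).
pose ddG w := w * dmills w + mills w.
have ddGE w : ddG w = ((1 + w ^+ 2) * Phi w + w * phi w) / phi w.
  by rewrite /ddG dmillsE /mills; field; exact: lt0r_neq0 (phi_gt0 w).
have [] := @MVT_segment R dmills ddG x y xy.
- by move=> c _; exact: is_derive_dmills.
- by apply: continuous_subspaceT; exact: (is_derive_continuous is_derive_dmills).
- move=> c _ ->; rewrite ler_wpM2r ?subr_ge0// ddGE.
  by rewrite divr_ge0 ?x2Phi_xphi_ge0// ltW// phi_gt0.
Qed.

(** The bounded solution f of f'(w) - w f(w) = 1[w <= z] - Phi z. *)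
Definition stein z w : R :=
  if w <= z then (1 - Phi z) * mills w else Phi z * mills (- w).

Lemma steinL z w : w <= z -> stein z w = (1 - Phi z) * mills w.
Proof. by rewrite /stein => ->. Qed.

Lemma steinR z w : z <= w -> stein z w = Phi z * mills (- w).
Proof.
rewrite /stein le_eqVlt => /predU1P[<-|]; last by rewrite ltNge => /negbTE ->.
by rewrite lexx /mills phiN PhiN mulrCA mulrA.
Qed.

Lemma is_derive_millsN w : is_derive w 1 (fun y : R => mills (- y)) (- dmills (- w)).
Proof.
by rewrite -mulrN1; exact: is_derive1_comp (is_derive_mills (- w)) (is_deriveNid w 1).
Qed.

Lemma is_derive_stein z w : w != z ->
  is_derive w 1 (stein z) ((w <= z)%R%:R - Phi z + w * stein z w).
Proof.
rewrite neq_lt => /orP[wz|zw].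
- have h : is_derive w 1 (fun y => (1 - Phi z) * mills y) ((1 - Phi z) * dmills w).
    exact: is_deriveZ (is_derive_mills w).
  rewrite (ltW wz) steinL ?ltW//.
  have -> : true%:R - Phi z + w * ((1 - Phi z) * mills w) = (1 - Phi z) * dmills w.
    by rewrite /dmills /=; ring.
  apply: near_eq_is_derive h; near=> y; rewrite steinL//.
  by apply: ltW; near: y; exact: lt_nbhsl.
- have h : is_derive w 1 (fun y => Phi z * mills (- y)) (Phi z * - dmills (- w)).
    exact: is_deriveZ (is_derive_millsN w).
  rewrite leNgt zw steinR ?ltW//.
  have -> : (~~ true)%:R - Phi z + w * (Phi z * mills (- w)) = Phi z * - dmills (- w).
    by rewrite /dmills /=; ring.
  apply: near_eq_is_derive h; near=> y; rewrite steinR//.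
  by apply: ltW; near: y; exact: lt_nbhsr.
Unshelve. all: by end_near. Qed.

(** The derivative of [stein z] from the left at z, which is also its largest
    value since [dmills] increases. *)
Definition stein_slope_max z : R := (1 - Phi z) * dmills z.

(** The derivative of [stein z] from the right at z, its smallest value. *)
Definition stein_slope_min z : R := - (Phi z * dmills (- z)).

(** The one-sided derivatives at z differ by the jump of the indicator function
    on the right-hand side of Stein's equation. That this jump is 1 is the
    reason for the constant 1 in front of the contaminated variance. *)
Lemma stein_jump z : stein_slope_max z - stein_slope_min z = 1.
Proof.
rewrite /stein_slope_max /stein_slope_min /dmills /mills phiN PhiN.
by field; exact: lt0r_neq0 (phi_gt0 z).
Qed.

Lemma stein_slope_min_le0 z : stein_slope_min z <= 0.
Proof. by rewrite oppr_le0 mulr_ge0 ?Phi_ge0 ?dmills_ge0. Qed.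

Lemma stein_slope_max_ge0 z : 0 <= stein_slope_max z.
Proof. by rewrite mulr_ge0 ?dmills_ge0// subr_ge0 Phi_le1. Qed.

(** The derivative of [stein z] is nonnegative and increasing to the left of z,
    nonpositive and increasing to the right, so that its extreme values are the
    one-sided limits at z. *)
Lemma stein_slopes z : slopes_between (stein z) (stein_slope_min z) (stein_slope_max z).
Proof.
have P1 := Phi_le1 z; have P0 := Phi_ge0 z.
have L x y : x <= y -> y <= z ->
    stein_slope_min z * (y - x) <= stein z y - stein z x <= stein_slope_max z * (y - x).
  move=> xy yz; rewrite !steinL ?(le_trans xy)//.
  apply: (mean_value_bounds (f := fun w => (1 - Phi z) * mills w)
      (df := fun w => (1 - Phi z) * dmills w) xy).
  - apply: (is_derive_continuous (df := fun w => (1 - Phi z) * dmills w)).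
    by move=> w; exact: is_deriveZ (is_derive_mills w).
  - by move=> w _ _; exact: is_deriveZ (is_derive_mills w).
  - move=> w xw wy; rewrite (le_trans (stein_slope_min_le0 z)) ?mulr_ge0 ?subr_ge0 ?dmills_ge0//=.
    by rewrite ler_wpM2l ?subr_ge0// dmills_nondecreasing// (le_trans (ltW wy)).
have Rr x y : x <= y -> z <= x ->
    stein_slope_min z * (y - x) <= stein z y - stein z x <= stein_slope_max z * (y - x).
  move=> xy zx; rewrite !steinR ?(le_trans zx)//.
  apply: (mean_value_bounds (f := fun w => Phi z * mills (- w))
      (df := fun w => Phi z * - dmills (- w)) xy).
  - apply: (is_derive_continuous (df := fun w => Phi z * - dmills (- w))).
    by move=> w; exact: is_deriveZ (is_derive_millsN w).
  - by move=> w _ _; exact: is_deriveZ (is_derive_millsN w).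
  - move=> w xw wy; rewrite mulrN lerN2 ler_wpM2l//=; last first.
      by rewrite dmills_nondecreasing// lerN2 (le_trans zx)// ltW.
    by rewrite (le_trans _ (stein_slope_max_ge0 z))// oppr_le0 mulr_ge0// dmills_ge0.
move=> x y xy; have [yz|/ltW zy] := leP y z; first exact: L.
have [zx|/ltW xz] := leP z x; first exact: Rr.
have /andP[? ?] := L _ _ xz (lexx _); have /andP[? ?] := Rr _ _ zy (lexx _).
by apply/andP; split; lra.
Qed.

Lemma stein_dist z x y : `|stein z y - stein z x| <= `|y - x|.
Proof.
have := stein_jump z; have := stein_slope_min_le0 z; have := stein_slope_max_ge0 z.
by move=> ? ? ?; apply: slopes_between_normr (@stein_slopes z) _ _; lra.
Qed.

(** Stein's equation bounds w f(w) by 1, hence f outside ]-1, 1[; inside, the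
    Lipschitz property gives at most 2 more than the value at 1. *)
Lemma stein_bounded z w : `|stein z w| <= 3.
Proof.
have far y : 1 <= `|y| -> `|stein z y| <= 1.
  move=> y1; rewrite -(mul1r `|stein z y|); apply: (@le_trans _ _ (`|y * stein z y|)).
    by rewrite normrM ler_wpM2r.
  have P1 := Phi_le1 z; have P0 := Phi_ge0 z.
  have /andP[J0 J1] : 0 <= 1 - Phi z <= 1 by lra.
  have [yz|/ltW zy] := leP y z.
    have -> : y * stein z y = (1 - Phi z) * dmills y - (1 - Phi z).
      by rewrite steinL// /dmills; ring.
    have h1 : 0 <= (1 - Phi z) * dmills y by rewrite mulr_ge0// dmills_ge0.
    have h2 : (1 - Phi z) * dmills y <= stein_slope_max z.
      by rewrite ler_wpM2l// dmills_nondecreasing.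
    have := stein_jump z; have := stein_slope_min_le0 z; rewrite ler_norml => ? ?.
    by apply/andP; split; lra.
  have -> : y * stein z y = Phi z - Phi z * dmills (- y).
    by rewrite steinR// /dmills; ring.
  have h1 : 0 <= Phi z * dmills (- y) by rewrite mulr_ge0// dmills_ge0.
  have h2 : Phi z * dmills (- y) <= - stein_slope_min z.
    by rewrite opprK ler_wpM2l// dmills_nondecreasing// lerN2.
  have := stein_jump z; have := stein_slope_max_ge0 z; rewrite ler_norml => ? ?.
  by apply/andP; split; lra.
have [w1|/ltW w1] := leP 1 `|w|; first by rewrite (le_trans (far _ w1))//; lra.
have /ler_normlP[s1 s1'] : `|stein z 1| <= 1 by apply: far; rewrite normr1.
have /ler_normlP[d1 d1'] : `|stein z w - stein z 1| <= 2.
  apply: (le_trans (stein_dist _ _ _)).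
  by move: w1; rewrite !ler_norml => /andP[? ?]; apply/andP; split; lra.
by apply/ler_normlP; split; lra.
Qed.

(** The test function is the average of [stein z] from w to w + delta. Its
    slopes are averages of those of [stein z]; its derivative, a difference
    quotient, inherits the Lipschitz property; and averaging Stein's equation
    replaces the factor w + t by w, with an error of at most delta times the
    bound 3 of [stein_bounded]. *)
Lemma smooth_stein z delta : 0 < delta -> exists psi g : R -> R, exists m M : R,
  [/\ M - m <= 1 /\ m <= 0 <= M,
      forall w, is_derive w 1 psi (g w),
      (forall w, m <= g w <= M) /\ (forall w, `|psi w| <= 3),
      forall x y, `|g y - g x| <= 2 / delta * `|y - x| &
      forall w, (w <= z - delta)%R%:R - Phi z - 3 * delta <= g w - w * psi w
                <= (w <= z)%R%:R - Phi z + 3 * delta].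
Proof.
move=> d0; set f := stein z.
have cf : continuous f.
  by apply: (lipschitz_continuous (K := 1)) => x y; rewrite mul1r stein_dist.
have [Pr iPr] := continuous_has_primitive cf.
have cPr : continuous Pr by exact: is_derive_continuous iPr.
pose psi w := delta^-1 * (Pr (w + delta) - Pr w).
pose g w := delta^-1 * (f (w + delta) - f w).
have dV0 : 0 < delta^-1 by rewrite invr_gt0.
exists psi, g, (stein_slope_min z), (stein_slope_max z); split.
- rewrite stein_slope_min_le0 stein_slope_max_ge0; split=> //.
  by have := stein_jump z; lra.
- move=> w.
  have iS : is_derive w 1 (fun y : R => y + delta) 1.
    by rewrite -[X in is_derive _ _ _ X]addr0;
      exact: is_deriveD (is_derive_id w 1) (is_derive_cst delta w 1).
  have iC := @is_derive1_comp R Pr (fun y => y + delta) w _ _ (iPr (w + delta)) iS.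
  rewrite mulr1 in iC.
  exact: is_deriveZ (is_deriveB iC (iPr w)).
- have wd w : w <= w + delta by lra.
  have wE w : w + delta - w = delta by ring.
  have f3 w : - 3 <= f w <= 3 by rewrite -ler_norml; exact: stein_bounded.
  split=> w.
    have := stein_slopes z (wd w); rewrite wE.
    by rewrite /g ler_pdivlMl// ler_pdivrMl// ![delta * _]mulrC.
  have := mean_value_bounds (wd w) cPr (fun y _ _ => iPr y) (fun y _ _ => f3 y).
  rewrite wE.
  by rewrite ler_norml /psi ler_pdivlMl// ler_pdivrMl// ![delta * _]mulrC.
- move=> x y; rewrite /g -mulrBr normrM gtr0_norm// [2 / delta]mulrC -mulrA.
  rewrite ler_pM2l//.
  have h1 : `|f y - f x| <= `|y - x| := stein_dist z x y.
  have h2 : `|f (y + delta) - f (x + delta)| <= `|y - x|.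
    by rewrite (le_trans (stein_dist z _ _))// opprD addrACA subrr addr0.
  rewrite (_ : _ - _ = (f (y + delta) - f (x + delta)) - (f y - f x)); last by ring.
  by apply: (le_trans (ler_normB _ _)); lra.
- move=> w.
  set lo := _ - Phi z - _; set hi := _ - Phi z + _.
  (* over the window, H increases by delta * (g w - w * psi w) *)
  pose H u := f u - w * Pr u.
  have cH : continuous H.
    move=> u; apply: continuousB; first exact: cf.
    by apply: continuousM; [exact: cst_continuous|exact: cPr].
  have slope a b : w <= a -> a <= b -> b <= w + delta -> (b <= z) || (z <= a) ->
      lo * (b - a) <= H b - H a <= hi * (b - a).
    move=> wa ab bw zab.
    apply: (mean_value_bounds
      (df := fun u => (u <= z)%R%:R - Phi z + (u - w) * f u) ab cH).
      move=> u au ub.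
      have uz : u != z by apply/eqP => uz; move: zab; rewrite -uz; lra.
      rewrite (_ : _ + _ = (u <= z)%R%:R - Phi z + u * f u - w * f u); last by ring.
      exact: is_deriveB (is_derive_stein uz) (is_deriveZ w (iPr u)).
    move=> u au ub; have /ler_normlP[f1 f2] := stein_bounded z u.
    rewrite -/f in f1 f2.
    have h1 : - (3 * delta) <= (u - w) * f u <= 3 * delta by apply/andP; split; nra.
    case/andP: h1 => h1 h2.
    have h3 : (w <= z - delta)%R%:R <= (u <= z)%R%:R :> R.
      by rewrite ler_nat; case: (lerP u z) => uz; case: lerP => // wz; lra.
    have h4 : (u <= z)%R%:R <= (w <= z)%R%:R :> R.
      by rewrite ler_nat; case: (lerP u z) => uz; case: lerP => // wz; lra.
    by apply/andP; split; rewrite /lo /hi; lra.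
  suff : lo * delta <= H (w + delta) - H w <= hi * delta.
    have -> : H (w + delta) - H w = (g w - w * psi w) * delta.
      by rewrite /H /g /psi; field; lra.
    by rewrite !ler_pM2r.
  (* H is not differentiable at z, where the window has to be cut *)
  have wdE : w + delta - w = delta by ring.
  have [zw|wz] := leP z w.
    by have := slope w (w + delta); rewrite zw orbT wdE; apply; lra.
  have [dz|zd] := leP (w + delta) z.
    by have := slope w (w + delta); rewrite dz wdE; apply; lra.
  have := slope w z (lexx _) (ltW wz) (ltW zd); rewrite lexx => /(_ isT) /andP[? ?].
  have := slope z (w + delta) (ltW wz) (ltW zd) (lexx _).
  rewrite lexx orbT => /(_ isT) /andP[? ?].
  by apply/andP; split; lra.
Qed.

End stein_solution.

(** * Sums of independent random variables *)

Section pair_of_random_variables.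
Context d (T : measurableType d) (R : realType) (P : probability T R).
Implicit Types (X Y : {RV P >-> R}) (E : set T).
Local Open Scope ereal_scope.

Definition pair_rv X Y (w : T) : R * R := (X w, Y w).

Let measurable_pair_rv X Y : measurable_fun setT (pair_rv X Y).
Proof. exact: measurable_fun_pair. Qed.

HB.instance Definition _ X Y :=
  isMeasurableFun.Build _ _ _ _ (pair_rv X Y) (@measurable_pair_rv X Y).

(** Both sides are finite measures in C, and measurable rectangles form a
    pi-system that generates the product sigma-algebra. *)
Lemma pair_indep_event X Y E : measurable E ->
  (forall A B, measurable A -> measurable B ->
    P (X @^-1` A `&` Y @^-1` B `&` E) = P (X @^-1` A `&` Y @^-1` B) * P E) ->
  forall C : set (R * R), measurable C ->
    P ((fun w => (X w, Y w)) @^-1` C `&` E) =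
    P ((fun w => (X w, Y w)) @^-1` C) * P E.
Proof.
move=> mE XYE C mC.
pose c : {nonneg R} := NngNum (fine_ge0 (measure_ge0 P E)).
have cE : c%:num%:E = P E by rewrite /c /= fineK// fin_num_measure.
pose G : set (set (R * R)) := [set A1 `*` A2 | A1 in measurable & A2 in measurable].
pose m1 := pushforward (mrestr P mE) (pair_rv X Y).
pose m2 := mscale c (distribution P (pair_rv X Y)).
suff : m1 C = m2 C by rewrite /m1 /m2 /mscale/= cE muleC.
apply: (measure_unique G (fun=> setT)) => //.
- by rewrite measurable_prod_measurableType.
- move=> _ _ [A1 mA1 [A2 mA2 <-]] [B1 mB1 [B2 mB2 <-]].
  exists (A1 `&` B1); first exact: measurableI.
  by exists (A2 `&` B2); [exact: measurableI|rewrite setXI].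
- by move=> _; exists setT => //; exists setT => //; rewrite setXTT.
- by rewrite bigcup_const.
- move=> _ [A mA [B mB <-]].
  by have := XYE A B mA mB; rewrite /m2/= /mscale/= cE muleC.
- move=> _; apply: (@le_lt_trans _ _ 1); last exact: ltry.
  rewrite /= /pushforward /mrestr preimage_setT setTI.
  exact: probability_le1.
Qed.
End pair_of_random_variables.

Section partial_sums.
Context d (T : measurableType d) (R : realType) (P : probability T R).
Variable X : nat -> {RV P >-> R}.
Local Open Scope ereal_scope.

Definition sum_over (s : seq nat) (w : T) : R := (\sum_(i <- s) X i w)%R.

Let measurable_sum_over s : measurable_fun setT (sum_over s).
Proof.
rewrite (_ : sum_over s = (fun w => \sum_(i <- s) X i w)%R)//.
by apply: measurable_sum.
Qed.

HB.instance Definition _ s :=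
  isMeasurableFun.Build _ _ _ _ (sum_over s) (@measurable_sum_over s).

Hypothesis X_indep : mutually_independent X.

Let event (J : {fset nat}) (A : nat -> set R) :=
  \bigcap_(i in [set` J]) (X i @^-1` A i).

Let measurable_event J A : (forall i, measurable (A i)) -> measurable (event J A).
Proof.
move=> mA; apply: fin_bigcap_measurable; first exact: finite_fset.
by move=> i _; rewrite -[X in measurable X]setTI; exact: measurable_funPT.
Qed.

(** The events on indices outside s make the induction on s possible: when X_i
    joins the sum, an event on X_i alone is moved to this second family, and
    [pair_indep_event] passes from the pair (sum, X_i) to its sum. *)
Lemma sum_over_indep_event (s : seq nat) (J : {fset nat}) (A : nat -> set R)
    (B : set R) : uniq s -> (forall i, i \in s -> i \notin J) ->
  (forall i, measurable (A i)) -> measurable B ->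
  P (sum_over s @^-1` B `&` event J A) = P (sum_over s @^-1` B) * P (event J A).
Proof.
elim: s J A B => [|i s IH] J A B.
  move=> _ _ mA mB.
  have [B0|B0] := pselect (B 0%R).
    rewrite (_ : sum_over [::] @^-1` B = setT).
      by rewrite setTI probability_setT mul1e.
    by apply/seteqP; split => // w _; rewrite /= /sum_over big_nil.
  rewrite (_ : sum_over [::] @^-1` B = set0) ?set0I ?measure0 ?mul0e//.
  by apply/seteqP; split => // w /=; rewrite /sum_over big_nil.
move=> /= /andP[is_ us] sJ mA mB.
have iJ : i \notin J by apply: sJ; rewrite mem_head.
have sJ' j : j \in s -> j \notin J.
  by move=> js; apply: sJ; rewrite in_cons js orbT.
pose C : set (R * R) := (fun xy => xy.1 + xy.2)%R @^-1` B.
have mC : measurable C.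
  by rewrite -[C]setTI; apply: (measurable_funD measurable_fst measurable_snd).
have sumE : sum_over (i :: s) @^-1` B = (fun w => (sum_over s w, X i w)) @^-1` C.
  by apply/seteqP; split => w; rewrite /C/= /sum_over big_cons addrC.
rewrite sumE; apply: pair_indep_event => //; first exact: measurable_event.
move=> B1 A1 mB1 mA1.
pose A' j := if j == i then A1 else A j.
have mA' j : measurable (A' j) by rewrite /A'; case: ifP.
have eventE (K : {fset nat}) : i \notin K ->
    event (i |` K)%fset A' = X i @^-1` A1 `&` event K A.
  move=> iK; apply/seteqP; split=> w /=.
    move=> h; split; first by have := h i; rewrite /A' eqxx; apply; rewrite /= !inE eqxx.
    move=> j /= jK; have := h j; rewrite /A'; case: eqP => [ji|_].
      by move: iK; rewrite -ji jK.
    by apply; rewrite /= !inE jK orbT.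
  move=> [h1 h2] j /=; rewrite !inE /A'; case: eqP => [->//|_ /= jK].
  exact: h2.
have XiE (K : {fset nat}) : i \notin K ->
    P (X i @^-1` A1 `&` event K A) = P (X i @^-1` A1) * P (event K A).
  move=> iK; rewrite -eventE// /event !X_indep//.
  rewrite big_fsetU1//= {1}/A' eqxx; congr (_ * _).
  apply: eq_big_seq => j jK; rewrite /A'; case: eqP => // ji.
  by move: iK; rewrite -ji jK.
have h0 := IH (i |` fset0)%fset A' B1 us _ mA' mB1.
rewrite !eventE ?inE// in h0.
rewrite -setIA -eventE// IH//; last first.
  by move=> j js; rewrite !inE negb_or sJ'// andbT; apply: contraNneq is_ => <-.
rewrite eventE// XiE// muleA; congr (_ * _).
have eT : event fset0 A = setT by apply/seteqP; split => // w _ j.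
rewrite eT setIT in h0; rewrite h0// => j js.
by rewrite !inE orbF; apply: contraNneq is_ => <-.
Qed.

Lemma sum_over_indep (s : seq nat) k (A B : set R) : uniq s -> k \notin s ->
  measurable A -> measurable B ->
  P (X k @^-1` A `&` sum_over s @^-1` B) = P (X k @^-1` A) * P (sum_over s @^-1` B).
Proof.
move=> us ks mA mB.
have := @sum_over_indep_event s [fset k]%fset (fun=> A) B us _ (fun=> mA) mB.
rewrite /event set_fset1 bigcap_set1 setIC muleC; apply => j js.
by rewrite !inE; apply: contraNneq ks => <-.
Qed.
End partial_sums.

Section expectation_of_independent_pair.
Context d (T : measurableType d) (R : realType) (P : probability T R).
Implicit Types (X Y : {RV P >-> R}).

(** By Fubini's theorem the expectation is an average over the law of Y of the
    integrals bounded by hypothesis. *)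
Lemma indep_expectation_bound X Y (q : R -> R -> R) (c : R) :
  (forall A B, measurable A -> measurable B ->
    P (X @^-1` A `&` Y @^-1` B) = (P (X @^-1` A) * P (Y @^-1` B))%E) ->
  measurable_fun setT (fun xy : R * R => q xy.1 xy.2) ->
  P.-integrable setT (fun w => (q (X w) (Y w))%:E) ->
  (forall y, (`| \int[distribution P X]_x (q x y)%:E | <= c%:E)%E) ->
  (`| \int[P]_w (q (X w) (Y w))%:E | <= c%:E)%E.
Proof.
move=> XY mq iq qc.
pose f (z : R * R) := (q z.1 z.2)%:E.
have mf : measurable_fun setT f by exact/measurable_EFinP.
pose m1 := distribution P X; pose m2 := distribution P Y.
pose m' := distribution P (pair_rv X Y).
have mE C : measurable C -> (m1 \x m2)%E C = m' C.
  by apply: product_measure_unique => A B mA mB; exact: XY.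
have iqf : (m1 \x m2)%E.-integrable setT f.
  apply/integrableP; split => //.
  rewrite (@eq_measure_integral _ _ _ _ m'); last by move=> A mA _; exact: mE.
  rewrite ge0_integral_distribution//; last exact: measurableT_comp.
  by case/integrableP : iq.
have -> : (\int[P]_w (q (X w) (Y w))%:E = \int[m2]_y \int[m1]_x f (x, y))%E.
  rewrite integral21_prod_meas1//.
  rewrite (@eq_measure_integral _ _ _ _ m'); last by move=> A mA _; exact: mE.
  by rewrite integral_distribution.
have mG := measurable_fubini_G iqf.
apply: (le_trans (le_abse_integral _ _ _)) => //.
apply: (@le_trans _ _ (\int[m2]_y c%:E)%E).
  apply: ge0_le_integral => //.
  - exact: measurableT_comp.
  - by move=> y _; exact: qc.
have m2T : m2 setT = 1%E by exact: probability_setT.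
rewrite integral_cst//; apply: (@le_trans _ _ (c%:E * m2 setT)%E) => //.
by rewrite m2T mule1.
Qed.
End expectation_of_independent_pair.

(** * The law of a contaminated observation *)

Section cumulative_law.
Context {R : realType} (F : cumulativeBounded (0 : R) (1 : R)).

(** The Lebesgue-Stieltjes measure of F carries the sigma-algebra generated by
    the half-open intervals; its image under the identity is a measure for the
    sigma-algebra of R on which the random variables take their values. *)
Definition law_of : probability R R :=
  distribution (lebesgue_stieltjes_measure F) (real_id : {mfun _ >-> _}).

Lemma law_of_ray x : law_of `]-oo, x]%classic = (F x)%:E.
Proof. exact: cdf_lebesgue_stieltjes_id. Qed.

Lemma ge0_integral_law_of (f : R -> \bar R) : measurable_fun setT f ->
  (forall x, 0 <= f x)%E ->
  (\int[law_of]_x f x = \int[lebesgue_stieltjes_measure F]_x f x)%E.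
Proof. by move=> mf f0; rewrite ge0_integral_distribution. Qed.

Lemma integral_law_of (f : R -> \bar R) : measurable_fun setT f ->
  law_of.-integrable setT f ->
  (\int[law_of]_x f x = \int[lebesgue_stieltjes_measure F]_x f x)%E.
Proof.
move=> mf intf; rewrite integral_distribution//.
case/integrableP : intf => _ iF; apply/integrableP; split => //.
by rewrite ge0_integral_law_of// in iF; exact: measurableT_comp.
Qed.
End cumulative_law.

Section measures_on_the_line.
Context {R : realType}.
Local Open Scope ereal_scope.

Lemma measure_eq_rays (m1 m2 : {measure set R -> \bar R}) :
  m1 setT < +oo -> m1 setT = m2 setT -> (forall x, m1 `]-oo, x]%classic = m2 `]-oo, x]%classic) ->
  forall A, measurable A -> m1 A = m2 A.
Proof.
move=> m1T mT m12.
pose g (n : nat) : set R := `](- (n%:R : R))%R, +oo[%classic.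
have fin (m : {measure set R -> \bar R}) A : m setT < +oo -> measurable A ->
    m A \is a fin_num.
  move=> mfin mA; rewrite ge0_fin_numE//; apply: le_lt_trans mfin.
  by apply: le_measure; rewrite ?inE.
apply: (measure_unique (@RGenOInfty.G R) g) => //.
- exact: RGenOInfty.measurableE.
- move=> _ _ [x ->] [y ->]; exists (Num.max x y).
  apply/seteqP; split=> t /=; rewrite !in_itv/= !andbT gt_max; first by case=> -> ->.
  by case/andP.
- by move=> n; eexists.
- apply/seteqP; split => // x _; exists (Num.truncn `|x|)%R.+1 => //=.
  rewrite /g/= in_itv/= andbT ltrNl (le_lt_trans _ (truncnS_gt _))//.
  by rewrite (le_trans (ler_norm _))// normrN.
- move=> _ [x ->].
  have split_mass (m : {measure set R -> \bar R}) :
      m setT = m `]-oo, x]%classic + m `]x, +oo[%classic.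
    rewrite -measureU//.
      congr (m _); apply/seteqP; split => // t _ /=.
      by rewrite !in_itv/= andbT; case: leP; [left|right].
    apply/seteqP; split => // t [] /=; rewrite !in_itv/= andbT => tx.
    by rewrite ltNge tx.
  have diff (m : {measure set R -> \bar R}) : m setT < +oo ->
      m `]x, +oo[%classic = m setT - m `]-oo, x]%classic.
    by move=> mfin; rewrite (split_mass m) [X in _ = X - _]addeC addeK// fin.
  rewrite (diff m1 m1T) (diff m2) -?mT//; congr (_ - _); exact: m12.
- by move=> n; rewrite -ge0_fin_numE ?fin//; exact: measurable_itv.
Qed.

Lemma integral_mscale d (T : measurableType d) (m : {measure set T -> \bar R})
    (k : {nonneg R}) (f : T -> \bar R) : m.-integrable setT f ->
  \int[mscale k m]_x f x = k%:num%:E * \int[m]_x f x.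
Proof.
move=> intf; have mf := measurable_int _ intf.
have mp := measurable_funepos mf; have mn := measurable_funeneg mf.
rewrite [LHS]integralE (ge0_integral_mscale _ _ k mp)// (ge0_integral_mscale _ _ k mn)//.
have fp := integrable_pos_fin_num measurableT intf.
have fn := integrable_neg_fin_num measurableT intf.
by rewrite -muleBr ?fin_num_adde_defr// [in RHS]integralE.
Qed.

Lemma integrable_mscale d (T : measurableType d) (m : {measure set T -> \bar R})
    (k : {nonneg R}) (f : T -> \bar R) : m.-integrable setT f ->
  (mscale k m).-integrable setT f.
Proof.
move=> /[dup] intf /integrableP[mf iF]; apply/integrableP; split => //.
rewrite ge0_integral_mscale//; last exact: measurableT_comp.
by rewrite lte_mul_pinfty.
Qed.

Lemma integrable_measure_add d (T : measurableType d)
    (m1 m2 : {measure set T -> \bar R}) (f : T -> \bar R) :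
  m1.-integrable setT f -> m2.-integrable setT f ->
  (measure_add m1 m2).-integrable setT f.
Proof.
move=> /integrableP[mf i1] /integrableP[_ i2]; apply/integrableP; split => //.
rewrite ge0_integral_measure_add//; last exact: measurableT_comp.
by rewrite lte_add_pinfty.
Qed.
End measures_on_the_line.

Section contaminated_law.
Context d (T : measurableType d) (R : realType) (P : probability T R).
Variables (Q : probability R R) (X : {RV P >-> R}) (p mu sigma : R).
Hypothesis p01 : 0 <= p <= 1.
Hypothesis sigma0 : 0 < sigma.
Hypothesis X_cdf : forall x, cdf X x =
  ((1 - p)%:E * Q `]-oo, (x - mu)%R]%classic +
   p%:E * Q `]-oo, ((x - mu) / sigma)%R]%classic)%E.
Local Open Scope ereal_scope.

Let affine (a x : R) : R := (a * x + mu)%R.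

Let measurable_affine a : measurable_fun setT (affine a).
Proof. by apply: measurable_funD => //; exact: measurable_funM. Qed.

HB.instance Definition _ a :=
  isMeasurableFun.Build _ _ _ _ (affine a) (@measurable_affine a).

Let p0 : (0 <= p)%R. Proof. by case/andP : p01. Qed.
Let q0 : (0 <= 1 - p)%R. Proof. by rewrite subr_ge0; case/andP : p01. Qed.

Let mix : set R -> \bar R := measure_add
  (mscale (NngNum q0) (distribution Q (affine 1)))
  (mscale (NngNum p0) (distribution Q (affine sigma))).

Let mixE A : mix A = (1 - p)%:E * distribution Q (affine 1) A +
  p%:E * distribution Q (affine sigma) A.
Proof. by rewrite /mix measure_addE. Qed.

Let mixT : mix setT = 1.
Proof.
rewrite mixE !probability_setT !mule1 -EFinD; congr (_%:E); ring.
Qed.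

Let P_mix A : measurable A -> distribution P X A = mix A.
Proof.
move=> mA; apply: measure_eq_rays => //.
- by apply: (@le_lt_trans _ _ 1); [exact: probability_le1|exact: ltry].
- exact: (etrans (probability_setT (distribution P X)) (esym mixT)).
move=> x; apply: (etrans (X_cdf x)); apply/esym; apply: (etrans (mixE _)); apply/esym.
congr (_ * _ + _ * _).
  rewrite /distribution/= /pushforward; congr (Q _).
  by apply/seteqP; split => y; rewrite /= !in_itv/= /affine mul1r lerBrDr.
rewrite /distribution/= /pushforward; congr (Q _).
by apply/seteqP; split => y; rewrite /= !in_itv/= /affine ler_pdivlMr// lerBrDr mulrC.
Qed.

(** The law of X agrees on rays with the mixture of the images of Q under
    x |-> x + mu and x |-> sigma x + mu. *)
Lemma contaminated_expectation (f : R -> R) : measurable_fun setT f ->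
  Q.-integrable setT (fun x => (f (x + mu))%:E) ->
  Q.-integrable setT (fun x => (f (sigma * x + mu))%:E) ->
  (distribution P X).-integrable setT (EFin \o f) /\
  \int[distribution P X]_x (f x)%:E =
    (1 - p)%:E * \int[Q]_x (f (x + mu))%:E +
    p%:E * \int[Q]_x (f (sigma * x + mu))%:E.
Proof.
move=> mf i1 i2.
have mEf : measurable_fun setT (EFin \o f) by exact/measurable_EFinP.
have i1' : Q.-integrable setT ((EFin \o f) \o affine 1).
  by apply: eq_integrable i1 => // x _; rewrite /= /affine mul1r.
have j1 : (distribution Q (affine 1)).-integrable setT (EFin \o f).
  exact: integrable_pushforward.
have j2 : (distribution Q (affine sigma)).-integrable setT (EFin \o f).
  exact: integrable_pushforward.
have imix : (measure_add (mscale (NngNum q0) (distribution Q (affine 1)))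
   (mscale (NngNum p0) (distribution Q (affine sigma)))).-integrable setT (EFin \o f).
  by apply: integrable_measure_add; exact: integrable_mscale.
have muE g : \int[distribution P X]_x g x =
    \int[measure_add (mscale (NngNum q0) (distribution Q (affine 1)))
   (mscale (NngNum p0) (distribution Q (affine sigma)))]_x g x.
  by apply: eq_measure_integral => A mA _; exact: P_mix.
split.
  by apply/integrableP; split => //; rewrite muE; case/integrableP : imix.
rewrite muE integral_measure_add//; [|exact: integrable_mscale..].
rewrite !integral_mscale// !integral_distribution//=; congr (_ * _ + _).
by apply: eq_integral => x _; rewrite /affine mul1r.
Qed.
End contaminated_law.

(** * The contribution of one observation *)

Section real_integrals.
Context d (T : measurableType d) (R : realType) (mu : {measure set T -> \bar R}).
Implicit Types f h : T -> R.

Lemma normr_Rintegral_le f h : mu.-integrable setT (EFin \o f) ->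
  mu.-integrable setT (EFin \o h) -> (forall x, `|f x| <= h x) ->
  `| \int[mu]_x f x | <= \int[mu]_x h x.
Proof.
move=> fi hi fh; apply: (le_trans (le_normr_Rintegral _ fi)) => //.
apply: le_Rintegral => //; exact: integrable_norm.
Qed.

Lemma real_integrableD f h : mu.-integrable setT (EFin \o f) ->
  mu.-integrable setT (EFin \o h) -> mu.-integrable setT (EFin \o (fun x => f x + h x)).
Proof.
move=> fi hi; have -> : EFin \o (fun x => f x + h x) = ((EFin \o f) \+ (EFin \o h))%E by [].
exact: integrableD.
Qed.

Lemma real_integrableB f h : mu.-integrable setT (EFin \o f) ->
  mu.-integrable setT (EFin \o h) -> mu.-integrable setT (EFin \o (fun x => f x - h x)).
Proof.
move=> fi hi; have -> : EFin \o (fun x => f x - h x) = ((EFin \o f) \- (EFin \o h))%E by [].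
exact: integrableB.
Qed.

Lemma real_integrableZl c f : mu.-integrable setT (EFin \o f) ->
  mu.-integrable setT (EFin \o (fun x => c * f x)).
Proof.
move=> fi; have -> : EFin \o (fun x => c * f x) = (fun x => c%:E * (EFin \o f) x)%E by [].
exact: integrableZl.
Qed.
End real_integrals.

Lemma Rintegral_probability_cst d (T : measurableType d) (R : realType)
    (P : probability T R) (a : R) : \int[P]_x (cst a x) = a.
Proof.
rewrite Rintegral_cst//; have -> : fine (P setT) = 1 by rewrite probability_setT.
by rewrite mulr1.
Qed.

Section increments.
Context {R : realType}.
Variables (psi g : R -> R) (m M K : R).
Hypothesis psi' : forall w : R, is_derive w 1 psi (g w).
Hypothesis gmM : forall w, m <= g w <= M.
Hypothesis mM1 : M - m <= 1.
Hypothesis gK : forall x y, `|g y - g x| <= K * `|y - x|.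

Let increment_between (y b lo hi : R) :
  (forall u, `|u - y| <= `|b| -> lo <= g u <= hi) ->
  lo * b ^+ 2 <= b * (psi (y + b) - psi y) <= hi * b ^+ 2.
Proof.
move=> glh; have cpsi := is_derive_continuous psi'.
have [b0|/ltW b0] := leP 0 b.
  have /andP[h1 h2] : lo * (y + b - y) <= psi (y + b) - psi y <= hi * (y + b - y).
    apply: mean_value_bounds => //; first lra.
    move=> u yu ub; apply: glh; rewrite !ger0_norm//; lra.
  rewrite (_ : y + b - y = b) in h1 h2; last by ring.
  by rewrite ![_ * b ^+ 2]mulrC expr2 -!mulrA !ler_wpM2l// [b * _]mulrC ?h1// mulrC.
have /andP[h1 h2] : lo * (y - (y + b)) <= psi y - psi (y + b) <= hi * (y - (y + b)).
  apply: mean_value_bounds => //; first lra.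
  move=> u yu ub; apply: glh; rewrite !ler0_norm//; lra.
rewrite (_ : y - (y + b) = - b) in h1 h2; last by ring.
have -> : b * (psi (y + b) - psi y) = - b * (psi y - psi (y + b)) by ring.
have b0' : 0 <= - b by rewrite oppr_ge0.
have -> : lo * b ^+ 2 = - b * (lo * - b) by ring.
have -> : hi * b ^+ 2 = - b * (hi * - b) by ring.
by rewrite !ler_wpM2l.
Qed.

Lemma increment_bounds y b :
  m * b ^+ 2 <= b * (psi (y + b) - psi y) <= M * b ^+ 2.
Proof. by apply: increment_between. Qed.

(** The bound K |b| is the Lipschitz estimate of the Taylor remainder; the bound
    1, better for large b, holds because all slopes lie between m and M. *)
Lemma increment_taylor y b :
  `|b * (psi (y + b) - psi y) - b ^+ 2 * g y| <= b ^+ 2 * Num.min 1 (K * `|b|).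
Proof.
have b2 : 0 <= b ^+ 2 by rewrite sqr_ge0.
have /andP[g1 g2] := gmM y.
have [h|h] := leP 1 (K * `|b|).
  have /andP[h1 h2] := increment_bounds y b.
  have mM := mM1.
  have h3 : 0 <= (m - g y + 1) * b ^+ 2 by rewrite mulr_ge0//; lra.
  have h4 : 0 <= (g y + 1 - M) * b ^+ 2 by rewrite mulr_ge0//; lra.
  by rewrite ler_norml; apply/andP; split; lra.
have K0 : 0 <= K.
  by have := le_trans (normr_ge0 _) (gK 0 1); rewrite subr0 normr1 mulr1.
have /andP[h1 h2] : (g y - K * `|b|) * b ^+ 2 <= b * (psi (y + b) - psi y)
    <= (g y + K * `|b|) * b ^+ 2.
  apply: increment_between => u ub.
  have : `|g u - g y| <= K * `|b| by rewrite (le_trans (gK _ _))// ler_wpM2l.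
  by rewrite ler_norml => /andP[? ?]; apply/andP; split; lra.
by rewrite ler_norml; apply/andP; split; lra.
Qed.
End increments.

(** Both q x and a lie between m q and M q, which are at most q apart. *)
Lemma scaled_gap (R : realType) (q x a m M : R) : 0 <= q -> m <= x <= M ->
  m * q <= a <= M * q -> M - m <= 1 -> `|q * x - a| <= q.
Proof.
move=> q0 /andP[x1 x2] /andP[a1 a2] mM.
have h1 : 0 <= q * (M - x) by rewrite mulr_ge0 ?subr_ge0.
have h2 : 0 <= q * (x - m) by rewrite mulr_ge0 ?subr_ge0.
have h3 : 0 <= q * (1 - (M - m)) by rewrite mulr_ge0 ?subr_ge0.
by rewrite ler_norml; apply/andP; split; lra.
Qed.

Lemma normr_slope_le1 (R : realType) (x m M : R) :
  m <= x <= M -> m <= 0 <= M -> M - m <= 1 -> `|x| <= 1.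
Proof.
move=> /andP[? ?] /andP[? ?] ?.
by rewrite ler_norml; apply/andP; split; lra.
Qed.

Section one_summand.
Context {R : realType} (Q : probability R R).
Hypothesis Q_sqr : Q.-integrable setT (fun x : R => (x ^+ 2)%:E).
Hypothesis Q_mean : \int[Q]_x x = 0.
Hypothesis Q_var : \int[Q]_x (x ^+ 2) = 1.

Lemma quadratic_integrable (f : R -> R) (a : R) : measurable_fun setT f ->
  (forall x, `|f x| <= a * (1 + x ^+ 2)) -> Q.-integrable setT (EFin \o f).
Proof.
move=> mf fa.
have i1 : Q.-integrable setT (EFin \o (fun x : R => a * (1 + x ^+ 2))).
  apply/real_integrableZl/(real_integrableD (f := cst 1)) => //.
  exact: finite_measure_integrable_cst.
apply: le_integrable i1 => //; first exact/measurable_EFinP.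
by move=> x _ /=; rewrite lee_fin (le_trans (fa x))// ler_norm.
Qed.

(** Plays the part of the integral of x^2 over c |x| > eps in Lindeberg's
    condition, with the indicator function smoothed to the remainder of
    [increment_taylor]. *)
Definition lindeberg_tail (K c : R) : R :=
  \int[Q]_x (x ^+ 2 * Num.min 1 (K * (c * `|x|))).

Lemma normr_le_quadratic (x : R) : `|x| <= 2^-1 * (1 + x ^+ 2).
Proof. by rewrite ler_norml; have := sqr_ge0 (x - 1); have := sqr_ge0 (x + 1); nra. Qed.

Lemma linear_integrable (c : R) : Q.-integrable setT (EFin \o (fun x : R => c * x)).
Proof.
apply: (@quadratic_integrable _ `|c|); first exact: measurable_funM.
move=> x; rewrite normrM ler_wpM2l// (le_trans (normr_le_quadratic x))//.
by have := sqr_ge0 x; lra.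
Qed.

Lemma normr_integrable : Q.-integrable setT (EFin \o (fun x : R => `|x|)).
Proof.
apply: (@quadratic_integrable _ 1) => [|x]; first exact: measurableT_comp.
by rewrite normr_id (le_trans (normr_le_quadratic x))//; have := sqr_ge0 x; lra.
Qed.

Lemma tail_integrable K c : 0 <= K -> 0 <= c ->
  Q.-integrable setT (EFin \o (fun x => x ^+ 2 * Num.min 1 (K * (c * `|x|)))).
Proof.
move=> K0 c0; apply: (@quadratic_integrable _ 1).
  apply: measurable_funM; first exact: measurable_funX.
  apply: measurable_minr => //.
  by do 2 apply: measurable_funM => //; exact: measurableT_comp.
move=> x; rewrite mul1r ger0_norm; last first.
  by rewrite mulr_ge0 ?sqr_ge0// le_min ler01 !mulr_ge0.
rewrite (@le_trans _ _ (x ^+ 2))//; last by rewrite lerDr.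
by rewrite ler_piMr ?sqr_ge0// ge_min lexx.
Qed.

Variables (psi g : R -> R) (m M K C : R).
Hypothesis psi' : forall w : R, is_derive w 1 psi (g w).
Hypothesis gmM : forall w, m <= g w <= M.
Hypothesis m0 : m <= 0 <= M.
Hypothesis mM1 : M - m <= 1.
Hypothesis gK : forall x y, `|g y - g x| <= K * `|y - x|.
Hypothesis psiC : forall w, `|psi w| <= C.
Hypothesis g_cont : continuous g.

Let K0 : 0 <= K.
Proof. by have := le_trans (normr_ge0 _) (gK 0 1); rewrite subr0 normr1 mulr1. Qed.
Let g1 w : `|g w| <= 1.
Proof. exact: normr_slope_le1 (gmM w) m0 mM1. Qed.

Let mpsi : measurable_fun setT psi.
Proof. apply: continuous_measurable_fun; exact: is_derive_continuous psi'. Qed.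
Let mg : measurable_fun setT g. Proof. exact: continuous_measurable_fun. Qed.

Let maff (y c : R) : measurable_fun setT (fun x : R => y + c * x).
Proof. by apply: measurable_funD => //; exact: measurable_funM. Qed.

Let B y c := \int[Q]_x g (y + c * x).
Let A y c := \int[Q]_x (c * x * psi (y + c * x)).

Lemma smooth_integrable y c : Q.-integrable setT (EFin \o (fun x => g (y + c * x))).
Proof.
apply: (@quadratic_integrable _ 1); first exact: measurableT_comp.
by move=> x; rewrite mul1r (le_trans (g1 _))//; have := sqr_ge0 x; lra.
Qed.

Lemma smooth_product_integrable y c :
  Q.-integrable setT (EFin \o (fun x => c * x * psi (y + c * x))).
Proof.
apply: (@quadratic_integrable _ (`|c| * C)).
  by apply: measurable_funM => //; exact: measurableT_comp.
move=> x; rewrite !normrM -!mulrA ler_wpM2l// mulrC ler_pM//.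
by rewrite (le_trans (normr_le_quadratic x))//; have := sqr_ge0 x; lra.
Qed.

Let icst (a : R) : Q.-integrable setT (EFin \o cst a).
Proof. exact: finite_measure_integrable_cst. Qed.

Let Rint_cst := Rintegral_probability_cst Q.

Let isqr (c : R) : Q.-integrable setT (EFin \o (fun x : R => c * x ^+ 2)).
Proof.
apply: (@quadratic_integrable _ `|c|).
  by apply: measurable_funM => //; exact: measurable_funX.
move=> x; rewrite normrM ler_wpM2l// ger0_norm ?sqr_ge0//; lra.
Qed.

Let Rint_lin (c : R) : \int[Q]_x (c * x) = 0.
Proof.
rewrite RintegralZl ?Q_mean ?mulr0//.
rewrite (_ : _ \o _ = EFin \o (fun x : R => 1 * x)); first exact: linear_integrable.
by apply/funext => x /=; rewrite mul1r.
Qed.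

Let Rint_sqr (c : R) : \int[Q]_x (c * x ^+ 2) = c.
Proof. by rewrite RintegralZl ?Q_var ?mulr1. Qed.

Let Rint_abs : \int[Q]_x `|x| <= 1.
Proof.
have ia := normr_integrable; pose h (x : R) := cst 2^-1 x + 2^-1 * x ^+ 2.
have ih : Q.-integrable setT (EFin \o h).
  exact: real_integrableD.
apply: (@le_trans _ _ (\int[Q]_x h x)).
  apply: le_Rintegral => // x _; rewrite (le_trans (normr_le_quadratic x))// /h /=; lra.
by rewrite RintegralD// Rint_cst Rint_sqr; lra.
Qed.

Let B_bounds y c : m <= B y c <= M.
Proof.
have is_ := smooth_integrable; rewrite -(Rint_cst m) -(Rint_cst M).
by apply/andP; split; apply: le_Rintegral => // x _; have /andP[] := gmM (y + c * x).
Qed.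

Let B_near y c : 0 <= c -> `|B y c - g y| <= K * c.
Proof.
move=> c0; have ia := normr_integrable; have is_ := smooth_integrable.
rewrite -{1}(Rint_cst (g y)) -RintegralB//.
apply: (@le_trans _ _ (\int[Q]_x (K * c * `|x|))).
  apply: normr_Rintegral_le.
  - exact: (real_integrableB (h := cst (g y))).
  - exact/real_integrableZl/normr_integrable.
  - move=> x; rewrite (le_trans (gK _ _))// (_ : y + c * x - y = c * x); last by ring.
    by rewrite normrM (ger0_norm c0) mulrA.
rewrite RintegralZl//.
by rewrite ler_piMr// mulr_ge0.
Qed.

Let D_ y c (x : R) := c * x * (psi (y + c * x) - psi y).

Let iD y c : Q.-integrable setT (EFin \o D_ y c).
Proof.
have il := linear_integrable; have ip := smooth_product_integrable.
rewrite (_ : D_ y c = (fun x => c * x * psi (y + c * x) - (c * psi y) * x)).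
  exact: real_integrableB.
by apply/funext => x; rewrite /D_; ring.
Qed.

Let A_increment y c : A y c = \int[Q]_x D_ y c x.
Proof.
have il := linear_integrable; have ip := smooth_product_integrable.
rewrite -[LHS]subr0 -(Rint_lin (c * psi y)) -RintegralB//.
by apply: eq_Rintegral => x _; rewrite /D_; ring.
Qed.

Let A_bounds y c : m * c ^+ 2 <= A y c <= M * c ^+ 2.
Proof.
rewrite A_increment -(Rint_sqr (m * c ^+ 2)) -(Rint_sqr (M * c ^+ 2)).
apply/andP; split; apply: le_Rintegral => // x _.
  by have /andP[+ _] := increment_bounds psi' gmM y (c * x); rewrite exprMn mulrA.
by have /andP[_ +] := increment_bounds psi' gmM y (c * x); rewrite exprMn mulrA.
Qed.

Let A_near y c : 0 <= c ->
  `|A y c - c ^+ 2 * g y| <= c ^+ 2 * lindeberg_tail K c.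
Proof.
move=> c0; rewrite A_increment.
have -> : c ^+ 2 * g y = \int[Q]_x (c ^+ 2 * g y * x ^+ 2) by rewrite Rint_sqr.
rewrite -RintegralB// /lindeberg_tail -RintegralZl//; last exact: (tail_integrable K0 c0).
apply: normr_Rintegral_le.
- exact: real_integrableB.
- by apply: real_integrableZl; exact: (tail_integrable K0 c0).
- move=> x; have := increment_taylor psi' gmM mM1 gK y (c * x).
  rewrite normrM (ger0_norm c0) exprMn /D_ mulrA.
  by rewrite (_ : c ^+ 2 * x ^+ 2 * g y = c ^+ 2 * g y * x ^+ 2); last ring.
Qed.

(** The weights 1 - p and p, the scales 1 / s and sigma / s are those of the
    mixture; y stands for the standardized sum of the other observations. Summed
    over the observations, the first summand of the bound will tend to 0. The
    second is the price of a contaminated term, for which only the slope bounds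
    are available. *)
Lemma summand_error (p sigma s y : R) : 0 <= p <= 1 -> 1 <= sigma -> 0 < s ->
  `| (((1 - p) + p * sigma ^+ 2) / s ^+ 2) *
       ((1 - p) * \int[Q]_x g (y + s^-1 * x) +
        p * \int[Q]_x g (y + sigma / s * x)) -
     ((1 - p) * \int[Q]_x (s^-1 * x * psi (y + s^-1 * x)) +
      p * \int[Q]_x (sigma / s * x * psi (y + sigma / s * x))) |
  <= (K / s + p + lindeberg_tail K s^-1) / s ^+ 2 + p * sigma ^+ 2 / s ^+ 2.
Proof.
move=> /andP[p0 p1] sg1 s0.
have sV0 : 0 <= s^-1 by rewrite invr_ge0 ltW.
have := B_near y sV0; have := A_near y sV0.
have := B_bounds y s^-1; have := B_bounds y (sigma / s).
have := A_bounds y (sigma / s); have := gmM y.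
rewrite /B /A.
set a2 := \int[Q]_x _; set b2 := \int[Q]_x _; set b1 := \int[Q]_x _.
set a1 := \int[Q]_x _; set G := g y; set om := lindeberg_tail _ _.
set t := s^-1; have t0 : 0 <= t by [].
move=> /andP[G1 G2] /andP[a21 a22] /andP[b21 b22] /andP[b11 b12] ha hb.
have mM := mM1; have Kt0 : 0 <= K * t by rewrite mulr_ge0.
pose x : R := (1 - p) * b1 + p * b2.
have xG : `|x - G| <= K * t + p.
  have -> : x - G = (1 - p) * (b1 - G) + p * (b2 - G) by rewrite /x; ring.
  rewrite (le_trans (ler_normD _ _))// lerD//.
    rewrite normrM ger0_norm; last lra.
    by rewrite (le_trans _ hb)// ler_piMl//; lra.
  rewrite normrM ger0_norm// ler_piMr// ler_norml; apply/andP; split; lra.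
have xa : `|(sigma / s) ^+ 2 * x - a2| <= (sigma / s) ^+ 2.
  have /andP[x1 x2] : m <= x <= M.
    have h1 : 0 <= (1 - p) * (b1 - m) by rewrite mulr_ge0 ?subr_ge0.
    have h2 : 0 <= p * (b2 - m) by rewrite mulr_ge0 ?subr_ge0.
    have h3 : 0 <= (1 - p) * (M - b1) by rewrite mulr_ge0 ?subr_ge0.
    have h4 : 0 <= p * (M - b2) by rewrite mulr_ge0 ?subr_ge0.
    by rewrite /x; apply/andP; split; lra.
  by apply: (scaled_gap (m := m) (M := M)); rewrite ?sqr_ge0 ?x1 ?a21.
(* the error of replacing W by W_k in the slope, the Taylor remainder at scale
   1 / s, and the contaminated term *)
have -> : (1 - p + p * sigma ^+ 2) / s ^+ 2 * x - ((1 - p) * a1 + p * a2) =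
    (1 - p) * (t ^+ 2 * (x - G)) - (1 - p) * (a1 - t ^+ 2 * G) +
    p * ((sigma / s) ^+ 2 * x - a2).
  by rewrite /t; field; exact: lt0r_neq0.
have -> : (K / s + p + om) / s ^+ 2 + p * sigma ^+ 2 / s ^+ 2 =
    (t ^+ 2 * (K * t + p)) + t ^+ 2 * om + p * (sigma / s) ^+ 2.
  by rewrite /t; field; exact: lt0r_neq0.
have p10 : 0 <= 1 - p by lra.
have p1' : 1 - p <= 1 by lra.
rewrite (le_trans (ler_normD _ _))// lerD//; last first.
  by rewrite normrM ger0_norm// ler_wpM2l.
rewrite (le_trans (ler_normB _ _))// lerD//.
  rewrite normrM (ger0_norm p10) (le_trans _ (_ : `|t ^+ 2 * (x - G)| <= _))//.
    by rewrite ler_piMl.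
  by rewrite normrM ger0_norm ?sqr_ge0// ler_wpM2l ?sqr_ge0.
by rewrite normrM (ger0_norm p10) (le_trans _ ha)// ler_piMl.
Qed.

End one_summand.

Section lindeberg_tail_limit.
Context {R : realType} (Q : probability R R).
Hypothesis Q_sqr : Q.-integrable setT (fun x : R => (x ^+ 2)%:E).

Lemma lindeberg_tail_cvg0 (K : R) (c : nat -> R) : 0 <= K -> (forall n, 0 <= c n) ->
  c n @[n --> \oo] --> 0 ->
  lindeberg_tail Q K (c n) @[n --> \oo] --> (0 : R).
Proof.
move=> K0 c0 cc; pose f n (x : R) := (x ^+ 2 * Num.min 1 (K * (c n * `|x|)))%:E.
have intf n : Q.-integrable setT (f n) by exact: tail_integrable.
have [|||||_ _] := @dominated_convergence _ _ _ Q setT measurableT f (cst 0%E)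
   (fun x => (x ^+ 2)%:E).
- by move=> n; exact: measurable_int (intf n).
- exact: measurable_cst.
- apply/aeW => x _.
  apply/cvg_EFin; first by near=> n.
  rewrite /= (_ : 0 = x ^+ 2 * 0); last by rewrite mulr0.
  apply: cvgM; first exact: cvg_cst.
  apply: (@squeeze_cvgr _ _ _ _ (cst 0) (fun n => K * (c n * `|x|))).
  - near=> n; rewrite /cst le_min ler01 ge_min lexx orbT /= andbT.
    by rewrite !mulr_ge0.
  - exact: cvg_cst.
  - rewrite (_ : 0 = K * (0 * `|x|)); last by rewrite mul0r mulr0.
    by apply: cvgM; [exact: cvg_cst|apply: cvgM => //; exact: cvg_cst].
- exact: Q_sqr.
- apply/aeW => x n _; rewrite lee_fin ger0_norm.
    by rewrite ler_piMr ?sqr_ge0// ge_min lexx.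
  by rewrite mulr_ge0 ?sqr_ge0// le_min ler01 !mulr_ge0.
rewrite integral0 => h.
exact: (fine_cvg h).
Unshelve. all: by end_near. Qed.
End lindeberg_tail_limit.

(** * Stein's bound for the standardized mean *)

Section sum_of_integrals.
Context d (T : measurableType d) (R : realType) (mu : {measure set T -> \bar R}).

Lemma normr_Rintegral_sum_le (n : nat) (f : nat -> T -> R) (c : nat -> R) :
  mu.-integrable setT (EFin \o (fun=> 0 : R)) ->
  (forall k, (k < n)%N -> mu.-integrable setT (EFin \o f k)) ->
  (forall k, (k < n)%N -> `| \int[mu]_x f k x | <= c k) ->
  mu.-integrable setT (EFin \o (fun x => \sum_(k < n) f k x)) /\
  `| \int[mu]_x (\sum_(k < n) f k x) | <= \sum_(k < n) c k.
Proof.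
move=> i0; elim: n => [|n IH] fi fc.
  have E : (fun x : T => \sum_(k < 0) f k x) = (fun=> 0).
    by apply/funext => x; rewrite big_ord0.
  rewrite E; split=> //; rewrite big_ord0 (_ : Rintegral _ _ _ = 0) ?normr0//.
  by rewrite /Rintegral integral0.
have [|k kn|IHi IHb] := IH; [by move=> k kn; apply: fi; rewrite ltnS ltnW| |].
  by apply: fc; rewrite ltnS ltnW.
have E : (fun x : T => \sum_(k < n.+1) f k x) =
    (fun x => \sum_(k < n) f k x + f n x).
  by apply/funext => x; rewrite big_ord_recr.
rewrite E; split; first exact: (real_integrableD IHi (fi n _)).
rewrite big_ord_recr/= RintegralD//; last exact: fi.
by rewrite (le_trans (ler_normD _ _))// lerD// fc.
Qed.
End sum_of_integrals.

Section stein_bound.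
Context d (T : measurableType d) (R : realType) (P : probability T R).
Variables (Q : probability R R) (X : nat -> {RV P >-> R}).
Variables (mu : R) (p sigma : nat -> R).
Hypothesis Q_sqr : Q.-integrable setT (fun x : R => (x ^+ 2)%:E).
Hypothesis Q_mean : \int[Q]_x x = 0.
Hypothesis Q_var : \int[Q]_x (x ^+ 2) = 1.
Hypothesis p_range : forall k, 0 <= p k <= 1.
Hypothesis sigma_ge1 : forall k, 1 <= sigma k.
Hypothesis X_indep : mutually_independent X.
Hypothesis X_cdf : forall k x, cdf (X k) x =
  ((1 - p k)%:E * Q `]-oo, (x - mu)%R]%classic +
   (p k)%:E * Q `]-oo, ((x - mu) / sigma k)%R]%classic)%E.

Variables (psi g : R -> R) (m M K C : R).
Hypothesis psi' : forall w : R, is_derive w 1 psi (g w).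
Hypothesis gmM : forall w, m <= g w <= M.
Hypothesis m0 : m <= 0 <= M.
Hypothesis mM1 : M - m <= 1.
Hypothesis gK : forall x y, `|g y - g x| <= K * `|y - x|.
Hypothesis psiC : forall w, `|psi w| <= C.
Hypothesis g_cont : continuous g.

Variable n : nat.
Hypothesis n_gt0 : (0 < n)%N.

Let s : R := std_sum p sigma n.

Lemma var_sum_ge : n%:R <= var_sum p sigma n.
Proof.
rewrite /var_sum -[n in n%:R]card_ord -sumr_const ler_sum// => k _.
have /andP[p0 p1] := p_range k; have s1 := sigma_ge1 k.
have : 1 <= sigma k ^+ 2 by rewrite exprn_ege1.
nra.
Qed.

Lemma std_sum_sqr : std_sum p sigma n ^+ 2 = var_sum p sigma n.
Proof. by rewrite sqr_sqrtr// (le_trans _ var_sum_ge). Qed.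

Lemma std_sum_gt0 : 0 < std_sum p sigma n.
Proof. by rewrite sqrtr_gt0 (lt_le_trans _ var_sum_ge)// ltr0n. Qed.

Let s0 : 0 < s. Proof. exact: std_sum_gt0. Qed.

Let others k := [seq j <- iota 0 n | j != k].

(* the standardized sum of n.-1 observations whose raw sum is r *)
Let y (r : R) : R := s^-1 * (r - n.-1%:R * mu).

Let v k : R := ((1 - p k) + p k * sigma k ^+ 2) / s ^+ 2.

Let q k (x r : R) : R :=
  v k * g (y r + s^-1 * (x - mu)) - s^-1 * (x - mu) * psi (y r + s^-1 * (x - mu)).

Let W : T -> R := std_sample_mean p sigma X mu n.

Let sum_others k w : (k < n)%N ->
  \sum_(j < n) X j w = X k w + sum_over X (others k) w.
Proof.
move=> kn; rewrite -(big_mkord xpredT (fun j => X j w)) /index_iota subn0.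
by rewrite (bigD1_seq k) ?iota_uniq ?mem_iota//= /sum_over big_filter.
Qed.

Let W_sum w : W w = \sum_(k < n) s^-1 * (X k w - mu).
Proof.
rewrite /W /std_sample_mean /sample_mean -/s -mulr_sumr sumrB sumr_const card_ord.
by rewrite -mulr_natl; field; rewrite lt0r_neq0//= pnatr_eq0 -lt0n.
Qed.

Let W_split k w : (k < n)%N ->
  W w = y (sum_over X (others k) w) + s^-1 * (X k w - mu).
Proof.
move=> kn; rewrite /W /std_sample_mean /sample_mean -/s /y (sum_others w kn).
have -> : n%:R = n.-1%:R + 1 :> R by rewrite natr1 prednK.
by field; rewrite lt0r_neq0//= natr1 pnatr_eq0.
Qed.

Let v_sum : \sum_(k < n) v k = 1.
Proof.
rewrite -mulr_suml -/(var_sum p sigma n) /s std_sum_sqr divff// lt0r_neq0//.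
by rewrite -std_sum_sqr exprn_gt0.
Qed.

Let q_sum w : g (W w) - W w * psi (W w) =
  \sum_(k < n) q k (X k w) (sum_over X (others k) w).
Proof.
rewrite (eq_bigr (fun k : 'I_n => v k * g (W w) - s^-1 * (X k w - mu) * psi (W w))).
  by rewrite sumrB -(mulr_suml _ _ _ (g (W w))) v_sum mul1r -mulr_suml -W_sum.
by move=> k _; rewrite /q -W_split.
Qed.

Let g1 w : `|g w| <= 1.
Proof. exact: normr_slope_le1 (gmM w) m0 mM1. Qed.

Let mg : measurable_fun setT g. Proof. exact: continuous_measurable_fun. Qed.
Let mpsi : measurable_fun setT psi.
Proof. by apply: continuous_measurable_fun; exact: is_derive_continuous psi'. Qed.

Let mq k : measurable_fun setT (fun xr : R * R => q k xr.1 xr.2).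
Proof.
have mx : measurable_fun setT (fun xr : R * R => s^-1 * (xr.1 - mu)).
  apply: measurable_funM => //; apply: measurable_funB => //; exact: measurable_fst.
have my : measurable_fun setT (fun xr : R * R => y xr.2 + s^-1 * (xr.1 - mu)).
  apply: measurable_funD => //; apply: measurable_funM => //.
  apply: measurable_funB => //; exact: measurable_snd.
apply: measurable_funB; apply: measurable_funM => //; exact: measurableT_comp.
Qed.

Let q_bound k x r : `|q k x r| <= `|v k| + `|C * s^-1| * `|x - mu|.
Proof.
rewrite /q (le_trans (ler_normB _ _))// lerD//.
  by rewrite normrM ler_piMr.
rewrite !normrM -[leRHS]mulrA [leLHS]mulrC ler_wpM2r ?mulr_ge0//.
by rewrite (le_trans (psiC _))// ler_norm.
Qed.

Let sigma0 k : 0 < sigma k. Proof. exact: lt_le_trans (sigma_ge1 k). Qed.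

Let iXmu k : P.-integrable setT (EFin \o (fun w => X k w - mu)).
Proof.
have mf : measurable_fun setT (fun x : R => x - mu) by exact: measurable_funB.
have ilin := linear_integrable Q_sqr.
have i1 : Q.-integrable setT (fun x => (x + mu - mu)%:E).
  by apply: eq_integrable (ilin 1) => // x _ /=; rewrite addrK mul1r.
have i2 : Q.-integrable setT (fun x => (sigma k * x + mu - mu)%:E).
  by apply: eq_integrable (ilin (sigma k)) => // x _ /=; rewrite addrK.
have [iX _] := contaminated_expectation (p_range k) (sigma0 k) (X_cdf k) mf i1 i2.
apply/integrableP; split.
  by apply/measurable_EFinP; exact: measurable_funB.
case/integrableP : iX => _; rewrite ge0_integral_distribution//.
exact/measurableT_comp/measurable_EFinP.
Qed.

Let iq k : P.-integrable setT
  (EFin \o (fun w => q k (X k w) (sum_over X (others k) w))).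
Proof.
pose h w := cst `|v k| w + `|C * s^-1| * `|X k w - mu|.
have ih : P.-integrable setT (EFin \o h).
  apply: real_integrableD; first exact: finite_measure_integrable_cst.
  apply: real_integrableZl; exact: integrable_norm (iXmu k).
apply: (le_integrable measurableT _ _ ih).
  apply/measurable_EFinP.
  exact: (measurableT_comp (mq k) (measurable_fun_pair (measurable_funP (X k))
     (measurable_funP (sum_over X (others k))))).
move=> w _ /=; rewrite lee_fin (le_trans (q_bound _ _ _))// /h /=.
exact: ler_norm.
Qed.

Let c k : R := (K / s + p k + lindeberg_tail Q K s^-1) / s ^+ 2 + p k * sigma k ^+ 2 / s ^+ 2.

Let q_expectation k r :
  (`| \int[distribution P (X k)]_x (q k x r)%:E | <= (c k)%:E)%E.
Proof.
pose G a x : R := g (y r + a * x); pose H a x : R := a * x * psi (y r + a * x).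
have iG a : Q.-integrable setT (EFin \o G a).
  exact: (smooth_integrable Q_sqr gmM m0 mM1 g_cont).
have iH a : Q.-integrable setT (EFin \o H a).
  exact: (smooth_product_integrable Q_sqr psi' psiC).
have iGH a : Q.-integrable setT (EFin \o (fun x => v k * G a x - H a x)).
  by apply: real_integrableB => //; exact: real_integrableZl.
have E1 x : q k (x + mu) r = v k * G s^-1 x - H s^-1 x by rewrite /q addrK.
have E2 x : q k (sigma k * x + mu) r = v k * G (sigma k / s) x - H (sigma k / s) x.
  by rewrite /q addrK /G /H mulrA [s^-1 * _]mulrC.
have mqr : measurable_fun setT (fun x => q k x r).
  exact: (measurable_fun_pair1 r (mq k)).
have i1 : Q.-integrable setT (fun x => (q k (x + mu) r)%:E).
  by apply: eq_integrable (iGH s^-1) => // x _; rewrite E1.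
have i2 : Q.-integrable setT (fun x => (q k (sigma k * x + mu) r)%:E).
  by apply: eq_integrable (iGH (sigma k / s)) => // x _; rewrite E2.
have [iqr XE] := contaminated_expectation (p_range k) (sigma0 k) (X_cdf k) mqr i1 i2.
rewrite -EFin_normr_Rintegral// lee_fin.
have -> : \int[distribution P (X k)]_x q k x r =
    (1 - p k) * \int[Q]_x q k (x + mu) r + p k * \int[Q]_x q k (sigma k * x + mu) r.
  have f1 := integrable_fin_num measurableT i1.
  have f2 := integrable_fin_num measurableT i2.
  by rewrite /Rintegral XE fineD ?fin_numM// !fineM.
have IE a : \int[Q]_x (v k * G a x - H a x) = v k * \int[Q]_x G a x - \int[Q]_x H a x.
  by rewrite RintegralB ?RintegralZl//; exact: real_integrableZl.
under eq_Rintegral do rewrite E1.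
under [X in _ + _ * X]eq_Rintegral do rewrite E2.
rewrite !IE.
have := summand_error Q_sqr Q_mean Q_var psi' gmM m0 mM1 gK psiC g_cont
  (y r) (p_range k) (sigma_ge1 k) s0.
rewrite -/(v k) -/(c k); congr (`|_| <= _).
by rewrite /G /H; ring.
Qed.

(** The integrand is the sum over k of a function q k of X_k and of the sum of
    the other observations. Those two variables are independent, so it suffices
    to bound the integral of q k over the law of X_k for a fixed second
    argument, which is what [summand_error] does. *)
Lemma stein_equation_bound :
  `| \int[P]_w (g (W w) - W w * psi (W w)) | <=
  n%:R / s ^+ 2 * (K / s + lindeberg_tail Q K s^-1) + (\sum_(k < n) p k) / s ^+ 2 +
  (\sum_(k < n) p k * sigma k ^+ 2) / s ^+ 2.
Proof.
have -> : \int[P]_w (g (W w) - W w * psi (W w)) =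
    \int[P]_w (\sum_(k < n) q k (X k w) (sum_over X (others k) w)).
  by apply: eq_Rintegral => w _; exact: q_sum.
have [||_] := @normr_Rintegral_sum_le _ _ _ P n
  (fun k w => q k (X k w) (sum_over X (others k) w)) c _ (fun k _ => iq k).
- exact: finite_measure_integrable_cst.
- move=> k kn.
  have uk : uniq (others k) by rewrite filter_uniq// iota_uniq.
  have kk : k \notin others k by rewrite mem_filter eqxx.
  rewrite -lee_fin EFin_normr_Rintegral//.
  apply: (indep_expectation_bound (q := q k) (c := c k)) => //.
    by move=> A B mA mB; exact: sum_over_indep.
  exact: iq.
move=> h; apply: (le_trans h); rewrite /c big_split/= -!mulr_suml !big_split/=.
rewrite !sumr_const !card_ord -[(K / s) *+ n]mulr_natl -[lindeberg_tail _ _ _ *+ n]mulr_natl.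
rewrite le_eqVlt; apply/orP; left; apply/eqP.
field; exact: lt0r_neq0.
Qed.

End stein_bound.

(** * The Kolmogorov distance and its limit *)

Lemma Phi_increment (R : realType) (x delta : R) : 0 <= delta ->
  Phi (x + delta) <= Phi x + delta.
Proof.
move=> d0.
have /andP[_] : 0 * (x + delta - x) <= Phi (x + delta) - Phi x <= 1 * (x + delta - x).
  apply: (mean_value_bounds (df := phi)); first lra.
  - exact: is_derive_continuous (@is_derive_Phi R).
  - by move=> w _ _; exact: is_derive_Phi.
  - by move=> w _ _; rewrite phi_le1 ltW// phi_gt0.
lra.
Qed.

Section kolmogorov_bound.
Context d (T : measurableType d) (R : realType) (P : probability T R).
Variables (Q : probability R R) (X : nat -> {RV P >-> R}).
Variables (mu : R) (p sigma : nat -> R).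
Hypothesis Q_sqr : Q.-integrable setT (fun x : R => (x ^+ 2)%:E).
Hypothesis Q_mean : \int[Q]_x x = 0.
Hypothesis Q_var : \int[Q]_x (x ^+ 2) = 1.
Hypothesis p_range : forall k, 0 <= p k <= 1.
Hypothesis sigma_ge1 : forall k, 1 <= sigma k.
Hypothesis X_indep : mutually_independent X.
Hypothesis X_cdf : forall k x, cdf (X k) x =
  ((1 - p k)%:E * Q `]-oo, (x - mu)%R]%classic +
   (p k)%:E * Q `]-oo, ((x - mu) / sigma k)%R]%classic)%E.

Definition stein_error (K : R) (n : nat) : R :=
  let s := std_sum p sigma n in
  n%:R / s ^+ 2 * (K / s + lindeberg_tail Q K s^-1) +
  (\sum_(k < n) p k) / s ^+ 2 + (\sum_(k < n) p k * sigma k ^+ 2) / s ^+ 2.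

Let W n : {RV P >-> R} := std_sample_mean p sigma X mu n.

Let cdfW n x := fine (cdf (W n) x).

Let iind n x : P.-integrable setT (EFin \o (fun w => (W n w <= x)%R%:R : R)) /\
  \int[P]_w ((W n w <= x)%R%:R : R) = cdfW n x.
Proof.
have mW : measurable (W n @^-1` `]-oo, x]).
  by rewrite -[X in measurable X]setTI; exact: measurable_funP.
have E : (fun w => (W n w <= x)%R%:R : R) = \1_(W n @^-1` `]-oo, x]).
  apply/funext => w; rewrite indicE; congr ((nat_of_bool _)%:R).
  by apply/idP/idP; rewrite inE/= in_itv.
rewrite E; split; first exact: integrable_indic.
by rewrite /Rintegral integral_indic// setIT.
Qed.

(** The averaging window extends to the right of its base point, whence the shift
    of z by delta in one of the two bounds only. *)
Lemma test_function_bounds n (z delta : R) : (0 < n)%N -> 0 < delta ->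
  Phi z - 3 * delta - stein_error (2 / delta) n <= cdfW n z /\
  cdfW n (z - delta) <= Phi z + 3 * delta + stein_error (2 / delta) n.
Proof.
move=> n0 d0.
have [psi [g [m [M [[mM m0] psi' [gmM psi3] gK SE]]]]] := smooth_stein z d0.
have cg := lipschitz_continuous gK.
have := stein_equation_bound Q_sqr Q_mean Q_var p_range sigma_ge1 X_indep X_cdf
  psi' gmM m0 mM gK psi3 cg n0.
rewrite -/(stein_error (2 / delta) n) => eb.
pose D w := g (W n w) - W n w * psi (W n w).
have mg : measurable_fun setT g by exact: continuous_measurable_fun.
have mpsi : measurable_fun setT psi.
  by apply: continuous_measurable_fun; exact: is_derive_continuous psi'.
have mW : measurable_fun setT (W n) by exact: measurable_funP.
have icst (a : R) : P.-integrable setT (EFin \o cst a).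
  exact: finite_measure_integrable_cst.
have Rint_cst := Rintegral_probability_cst P.
have P0 := Phi_ge0 z; have P1 := Phi_le1 z.
have iD : P.-integrable setT (EFin \o D).
  apply: (le_integrable measurableT _ _ (icst (2 + 3 * delta))).
    apply/measurable_EFinP; apply: measurable_funB; first exact: measurableT_comp.
    by apply: measurable_funM => //; exact: measurableT_comp.
  move=> w _ /=; rewrite lee_fin [leRHS]ger0_norm; last lra.
  have b01 (b : bool) : 0 <= (b%:R : R) <= 1 by case: b; rewrite /= lexx ler01.
  have /andP[b1 _] := b01 (W n w <= z - delta); have /andP[_ b2] := b01 (W n w <= z).
  by have /andP[h1 h2] := SE (W n w); rewrite ler_norml /D; apply/andP; split; lra.
have [i1 E1] := iind n z; have [i2 E2] := iind n (z - delta).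
have up : \int[P]_w D w <= cdfW n z + (3 * delta - Phi z).
  rewrite -E1 -(Rint_cst (3 * delta - Phi z)) -RintegralD//.
  apply: le_Rintegral => //; first exact: real_integrableD.
  by move=> w _; have /andP[_ h] := SE (W n w); rewrite /D /cst; lra.
have lo : cdfW n (z - delta) - (3 * delta + Phi z) <= \int[P]_w D w.
  rewrite -E2 -(Rint_cst (3 * delta + Phi z)) -RintegralB//.
  apply: le_Rintegral => //; first exact: real_integrableB.
  by move=> w _; have /andP[h _] := SE (W n w); rewrite /D /cst; lra.
have /ler_normlP[h1 h2] : `|\int[P]_w D w| <= stein_error (2 / delta) n := eb.
by split; lra.
Qed.

Lemma kolmogorov_distance_bound d' (T' : measurableType d') (P' : probability T' R)
    (xi : {RV P' >-> R}) n (delta : R) :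
  has_standard_normal_law xi -> (0 < n)%N -> 0 < delta ->
  (kolmogorov_distance xi (W n) <=
     (stein_error (2 / delta) n + 4 * delta)%:E)%E.
Proof.
move=> xi_normal n0 d0; apply: ge_ereal_sup => _ [x _ <-].
have -> : cdf xi x = (Phi x)%:E.
  by rewrite /cdf xi_normal// /Phi fineK// fin_num_measure.
have -> : cdf (W n) x = (cdfW n x)%:E by rewrite /cdfW fineK// fin_num_measure.
have [lo _] := test_function_bounds x n0 d0.
have [_] := test_function_bounds (x + delta) n0 d0; rewrite addrK => up.
have := Phi_increment x (ltW d0) => inc.
rewrite -EFinB abse_EFin lee_fin ler_norml; apply/andP; split; lra.
Qed.
End kolmogorov_bound.

Section stein_error_limit.
Context {R : realType} (Q : probability R R) (p sigma : nat -> R) (L : R).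
Hypothesis Q_sqr : Q.-integrable setT (fun x : R => (x ^+ 2)%:E).
Hypothesis p_range : forall k, 0 <= p k <= 1.
Hypothesis sigma_ge1 : forall k, 1 <= sigma k.
Hypothesis L_ge0 : 0 <= L.
Hypothesis H1 : (n%:R^-1 * \sum_(k < n) p k * sigma k ^+ 2) @[n --> \oo] --> L.
Hypothesis H2 : (n%:R^-1 * \sum_(k < n) p k) @[n --> \oo] --> (0 : R).

Let s n : R := std_sum p sigma n.

Let s_sqr n : s n ^+ 2 = var_sum p sigma n.
Proof. exact: std_sum_sqr. Qed.

Let sV0 n : 0 <= (s n)^-1. Proof. by rewrite invr_ge0 sqrtr_ge0. Qed.

Lemma mean_variance_cvg : n%:R / s n ^+ 2 @[n --> \oo] --> (1 + L)^-1.
Proof.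
have E n : n%:R / s n ^+ 2 = (n%:R^-1 * var_sum p sigma n)^-1.
  by rewrite s_sqr invfM invrK.
under eq_fun do rewrite E.
apply: cvgV; first by rewrite gt_eqF// ltr_wpDr.
have -> : 1 + L = 1 - 0 + L by rewrite subr0.
have h : (1 - n%:R^-1 * (\sum_(k < n) p k) + n%:R^-1 * \sum_(k < n) p k * sigma k ^+ 2)
    @[n --> \oo] --> 1 - 0 + L.
  by apply: cvgD => //; apply: cvgB => //; exact: cvg_cst.
apply: cvg_trans h; apply: near_eq_cvg; near=> n.
have n0 : n%:R != 0 :> R by rewrite pnatr_eq0 -lt0n; near: n; exists 1%N.
have -> : var_sum p sigma n =
    n%:R - \sum_(k < n) p k + \sum_(k < n) p k * sigma k ^+ 2.
  by rewrite /var_sum big_split/= sumrB sumr_const card_ord.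
by field.
Unshelve. all: by end_near. Qed.

Lemma inv_std_sum_cvg0 : (s n)^-1 @[n --> \oo] --> (0 : R).
Proof.
apply/cvgrPdist_le => e e0; near=> n.
rewrite sub0r normrN ger0_norm//.
have n1 : (0 < n)%N by near: n; exists 1%N.
have sn0 : 0 < s n by exact: std_sum_gt0.
rewrite -[leRHS]invrK lef_pV2 ?posrE ?invr_gt0//.
rewrite -ler_sqr ?nnegrE ?invr_ge0 ?(ltW e0) ?(ltW sn0)// s_sqr.
apply: (le_trans _ (var_sum_ge p_range sigma_ge1 n)).
by near: n; exact: nbhs_infty_ger.
Unshelve. all: by end_near. Qed.

(** In the first term, s_n grows at least like the square root of n; the second
    is the mean of the p_k times n / s_n^2; the third is the mean of the
    p_k sigma_k^2 times n / s_n^2. *)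
Lemma stein_error_cvg (K : R) : 0 <= K ->
  stein_error Q p sigma K n @[n --> \oo] --> L / (1 + L).
Proof.
move=> K0.
have E n : stein_error Q p sigma K n =
    n%:R / s n ^+ 2 * (K * (s n)^-1 + lindeberg_tail Q K (s n)^-1) +
    (n%:R^-1 * \sum_(k < n) p k) * (n%:R / s n ^+ 2) +
    (n%:R^-1 * \sum_(k < n) p k * sigma k ^+ 2) * (n%:R / s n ^+ 2).
  rewrite /stein_error -/(s n); have [->|n0] := eqVneq n 0%N.
    by rewrite !big_ord0 mulr0n ?(mul0r, mulr0).
  have n0' : n%:R != 0 :> R by rewrite pnatr_eq0.
  have sn0 : s n != 0 by rewrite lt0r_neq0// std_sum_gt0// lt0n.
  by field; rewrite n0' sn0.
under eq_fun do rewrite E.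
have -> : L / (1 + L) = (1 + L)^-1 * (K * 0 + 0) + 0 * (1 + L)^-1 + L * (1 + L)^-1.
  by rewrite mulr0 addr0 mulr0 mul0r !add0r.
have hm := mean_variance_cvg; have hs := inv_std_sum_cvg0.
apply: cvgD; [apply: cvgD|]; apply: cvgM => //.
apply: cvgD; first by apply: cvgM => //; exact: cvg_cst.
exact: lindeberg_tail_cvg0.
Qed.

End stein_error_limit.

Lemma limn_esup_le_near (R : realType) (u : nat -> \bar R) (c : \bar R) :
  (\forall n \near \oo, (u n <= c)%E) -> (limn_esup u <= c)%E.
Proof.
move=> uc; apply: (@le_trans _ _ (ereal_sup (u @` [set n | (u n <= c)%E]))).
  by apply: ereal_inf_lbound => /=; exists [set n | (u n <= c)%E].
by apply: ge_ereal_sup => _ [n /= un <-].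
Qed.

Theorem theorem4p10 (R : realType)
    (d : measure_display) (T : measurableType d) (P : probability T R)
    (d' : measure_display) (T' : measurableType d') (P' : probability T' R)
    (F : cumulativeBounded (0 : R) (1 : R))
    (F_mean : (\int[lebesgue_stieltjes_measure F]_x x%:E = 0)%E)
    (F_second_moment :
      (\int[lebesgue_stieltjes_measure F]_x (x ^+ 2)%:E = 1)%E)
    (mu : R) (p sigma : nat -> R)
    (p_range : forall k, 0 <= p k <= 1)
    (sigma_ge1 : forall k, 1 <= sigma k)
    (X : nat -> {RV P >-> R})
    (X_indep : mutually_independent X)
    (X_cdf : forall k x,
      cdf (X k) x =
        ((1 - p k) * F (x - mu) + p k * F ((x - mu) / sigma k))%:E)
    (xi : {RV P' >-> R})
    (xi_normal : has_standard_normal_law xi)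
    (L : R) (L_ge0 : 0 <= L)
    (H1 : (n%:R^-1 * \sum_(k < n) p k * sigma k ^+ 2) @[n --> \oo] --> L)
    (H2 : (n%:R^-1 * \sum_(k < n) p k) @[n --> \oo] --> (0 : R))
    (H3 : ((std_sum p sigma n ^+ 2)^-1 *
             \big[Num.max/0]_(k < n) (p k * sigma k ^+ 2)) @[n --> \oo]
          --> (0 : R)) :
  (limn_esup (fun n => kolmogorov_distance xi
                         (std_sample_mean p sigma X mu n : {RV P >-> R}))
   <= (L / (1 + L))%:E)%E.
Proof.
pose Q := law_of F.
have mEsqr : measurable_fun setT (fun x : R => (x ^+ 2)%:E).
  by apply/measurable_EFinP; exact: measurable_funX.
have Qsqr1 : (\int[Q]_x (x ^+ 2)%:E = 1)%E.
  by rewrite ge0_integral_law_of// => x; rewrite lee_fin sqr_ge0.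
have Q_sqr : Q.-integrable setT (fun x : R => (x ^+ 2)%:E).
  apply/integrableP; split => //.
  under eq_integral do rewrite gee0_abs ?lee_fin ?sqr_ge0//.
  by rewrite Qsqr1 ltry.
have Q_var : \int[Q]_x (x ^+ 2) = 1 by rewrite /Rintegral Qsqr1.
have Q_id : Q.-integrable setT (fun x : R => x%:E).
  by apply: eq_integrable (linear_integrable Q_sqr 1) => // x _ /=; rewrite mul1r.
have Q_mean : \int[Q]_x x = 0.
  by rewrite /Rintegral integral_law_of ?F_mean//; exact/measurable_EFinP.
have X_cdf' k x : cdf (X k) x =
    ((1 - p k)%:E * Q `]-oo, (x - mu)%R]%classic +
     (p k)%:E * Q `]-oo, ((x - mu) / sigma k)%R]%classic)%E.
  by rewrite X_cdf EFinD !EFinM /Q !law_of_ray.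
apply/lee_addgt0Pr => e e0.
(* smoothing costs 4 * delta = e / 2, and the remaining e / 2 is left to n *)
pose delta := e / 8; have d0 : 0 < delta by rewrite divr_gt0.
have K0 : 0 <= 2 / delta by rewrite divr_ge0// ltW.
have err := stein_error_cvg Q_sqr p_range sigma_ge1 L_ge0 H1 H2 K0.
rewrite -EFinD; apply: limn_esup_le_near; near=> n.
have n0 : (0 < n)%N by near: n; exists 1%N.
apply: le_trans (kolmogorov_distance_bound Q_sqr Q_mean Q_var p_range sigma_ge1
  X_indep X_cdf' xi_normal n0 d0) _.
have en : stein_error Q p sigma (2 / delta) n <= L / (1 + L) + e / 2.
  by near: n; apply: (cvgr_le _ err); rewrite ltrDl divr_gt0.
by rewrite lee_fin /delta; lra.
Unshelve. all: by end_near. Qed.
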